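(* Let $l\ge 12$ and let $G$ be given by the presentation \[G=\langle a_1,a_2,\ldots,a_l : (a_1^na_2^n\cdots a_l^n)^2=1,\ n\in\mathbb{Z}\rangle.\] Then $G$ is residually finite, but $G$ is not virtually torsion-free and is not linear in characteristic zero. Every finite subgroup of $G$ has order at most $2$.
   Context: A group is linear in characteristic zero if it is isomorphic to a subgroup of $GL_k(K)$ for some $k$ and some field $K$ of characteristic zero. *)

(* Defs.v *)
From HB Require Import structures.
From mathcomp Require Import all_boot all_order all_fingroup all_algebra.
From mathcomp Require Import all_classical.

Set Implicit Arguments.
Unset Strict Implicit.
Unset Printing Implicit Defensive.

Local Open Scope classical_set_scope.
Local Open Scope group_scope.

(** Words in the letters [x] and [x^-1], encoded by [(x, false)] and
    [(x, true)]. *)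
Definition word (I : Type) := seq (I * bool).

Definition winv I (w : word I) : word I := rev [seq (x.1, ~~ x.2) | x <- w].

Definition wpow I (x : I) (n : int) : word I :=
  match n with
  | Posz m => nseq m (x, false)
  | Negz m => nseq m.+1 (x, true)
  end.

(** The least congruence on words that makes the letters [x] and [x^-1]
    mutually inverse and every relator [r \in rels] trivial. *)
Inductive word_equiv I (rels : set (word I)) : word I -> word I -> Prop :=
| WRefl u : word_equiv rels u u
| WSym u v : word_equiv rels u v -> word_equiv rels v u
| WTrans u v w :
    word_equiv rels u v -> word_equiv rels v w -> word_equiv rels u w
| WCat u u' v v' :
    word_equiv rels u u' -> word_equiv rels v v' ->
    word_equiv rels (u ++ v) (u' ++ v')
| WCancel x b : word_equiv rels [:: (x, b); (x, ~~ b)] [::]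
| WRel r : rels r -> word_equiv rels r [::].

Section Presentation.
Variables (I : choiceType) (rels : set (word I)).

Definition word_equivb : rel (word I) := fun u v => `[< word_equiv rels u v >].

Fact word_equivb_refl : reflexive word_equivb.
Proof. by move=> u; apply/asboolP/WRefl. Qed.

Fact word_equivb_sym : symmetric word_equivb.
Proof. by move=> u v; apply/asboolP/asboolP => /WSym. Qed.

Fact word_equivb_trans : transitive word_equivb.
Proof. by move=> v u w /asboolP uv /asboolP vw; apply/asboolP/(WTrans uv vw). Qed.

Canonical word_equiv_rel :=
  EquivRel word_equivb word_equivb_refl word_equivb_sym word_equivb_trans.

Local Open Scope quotient_scope.
Local Notation qrepr := generic_quotient.repr.

Definition presented := {eq_quot word_equiv_rel}.
HB.instance Definition _ := EqQuotient.on presented.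
HB.instance Definition _ := Choice.on presented.

Definition pres_class (u : word I) : presented := \pi_presented u.

Lemma pres_classP u v : pres_class u = pres_class v <-> word_equiv rels u v.
Proof.
split=> [/eqP|uv]; first by rewrite eqmodE => /asboolP.
by apply/eqP; rewrite eqmodE; apply/asboolP.
Qed.

Lemma pres_class_surj (x : presented) : exists u, x = pres_class u.
Proof. by exists (qrepr x); rewrite /pres_class reprK. Qed.

Lemma pres_reprP u : word_equiv rels (qrepr (pres_class u)) u.
Proof. by apply/pres_classP; rewrite {1}/pres_class reprK. Qed.

Definition pres_one : presented := pres_class [::].
Definition pres_mul (x y : presented) : presented :=
  pres_class (qrepr x ++ qrepr y).
Definition pres_inv (x : presented) : presented := pres_class (winv (qrepr x)).

Lemma pres_mulE u v :
  pres_mul (pres_class u) (pres_class v) = pres_class (u ++ v).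
Proof. by apply/pres_classP/WCat; apply: pres_reprP. Qed.

Lemma winvK : involutive (@winv I).
Proof.
move=> w; rewrite /winv map_rev revK -map_comp -[RHS]map_id.
by apply: eq_map => -[x b] /=; rewrite negbK.
Qed.

Lemma word_equiv_mulV u : word_equiv rels (u ++ winv u) [::].
Proof.
elim: u => [|[x b] u IHu]; first exact: WRefl.
rewrite /winv /= rev_cons -cats1 catA -/(winv u).
apply: WTrans (WCancel rels x b).
exact: (WCat (WRefl _ [:: (x, b)]) (WCat IHu (WRefl _ [:: (x, ~~ b)]))).
Qed.

Fact pres_mulA : associative pres_mul.
Proof.
move=> x y z; have [[u ->] [v ->] [w ->]] :=
  And3 (pres_class_surj x) (pres_class_surj y) (pres_class_surj z).
by rewrite (pres_mulE v) (pres_mulE u v) !pres_mulE catA.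
Qed.

Fact pres_mul1 : left_id pres_one pres_mul.
Proof. by move=> x; have [u ->] := pres_class_surj x; rewrite pres_mulE. Qed.

Fact pres_mulr1 : right_id pres_one pres_mul.
Proof.
by move=> x; have [u ->] := pres_class_surj x; rewrite pres_mulE cats0.
Qed.

Fact pres_mulrV : right_inverse pres_one pres_inv pres_mul.
Proof.
move=> x; rewrite /pres_inv; set u := qrepr x.
have -> : x = pres_class u by rewrite /pres_class reprK.
by rewrite pres_mulE; apply/pres_classP/word_equiv_mulV.
Qed.

Fact pres_mulV : left_inverse pres_one pres_inv pres_mul.
Proof.
move=> x; rewrite /pres_inv; set u := qrepr x.
have -> : x = pres_class u by rewrite /pres_class reprK.
rewrite pres_mulE -{2}[u]winvK.
exact/pres_classP/word_equiv_mulV.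
Qed.

HB.instance Definition _ := isGroup.Build presented
  pres_mulA pres_mul1 pres_mulr1 pres_mulV pres_mulrV.

Definition pres_gen (x : I) : presented := pres_class [:: (x, false)].

Definition weval (H : groupType) (f : I -> H) (w : word I) : H :=
  \prod_(x <- w) (if x.2 then (f x.1)^-1 else f x.1).

Lemma pres_universal (H : groupType) (f : I -> H) :
  (forall r, rels r -> weval f r = 1) ->
  exists phi : UMagmaMorphism.type presented H,
    forall x, phi (pres_gen x) = f x.
Proof.
move=> fr.
have fE u v : word_equiv rels u v -> weval f u = weval f v.
  elim=> {u v} [|u v _ ->|u v w _ -> _ ->|u u' v v' _ IHu _ IHv|x b|r] //.
  - by rewrite /weval !big_cat -!/(weval f _) IHu IHv.
  - by rewrite /weval !big_cons big_nil mulg1; case: b; rewrite (mulVg, mulgV).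
  - by move/fr->; rewrite /weval big_nil.
pose phi (x : presented) := weval f (qrepr x).
have phiE u : phi (pres_class u) = weval f u by exact/fE/pres_reprP.
have phiM : monoid_morphism phi.
  split=> [|x y]; first by rewrite phiE /weval big_nil.
  by rewrite phiE /weval big_cat.
pose mphi := isUMagmaMorphism.Build presented H phi phiM.
pose Phi : UMagmaMorphism.type presented H := HB.pack phi mphi.
by exists Phi => x; rewrite /= phiE /weval big_seq1.
Qed.

Lemma pres_classM u v : pres_class (u ++ v) = pres_class u * pres_class v.
Proof. exact/esym/pres_mulE. Qed.

Lemma pres_genV x : (pres_gen x)^-1 = pres_class [:: (x, true)].
Proof.
apply/esym/eqP; rewrite -divg_eq1 invgK -pres_classM.
exact/eqP/pres_classP/(WCancel _ x true).
Qed.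

Lemma pres_gen_ind (H : groupClosed presented) :
  (forall x, pres_gen x \in H) -> forall g, g \in H.
Proof.
move=> genH g; have [u ->] := pres_class_surj g.
elim: u => [|[x b] u IHu]; first exact: (gpred1 (s := H) : 1 \in H).
rewrite -cat1s pres_classM gpredM //.
by case: b; rewrite -?pres_genV ?gpredV; apply: genH.
Qed.

End Presentation.

Section GroupProperties.
Variable G : groupType.

Definition finite_index (H : {pred G}) : Prop :=
  finite_set (range (fun x : G => [set x * h | h in [set` H]])).

Definition torsion_free (H : {pred G}) : Prop :=
  forall h n, h \in H -> (0 < n)%N -> h ^+ n = 1 -> h = 1.

Definition virtually_torsion_free : Prop :=
  exists H : groupClosed G, finite_index H /\ torsion_free H.

Definition residually_finite : Prop :=
  forall g : G, g <> 1 ->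
    exists (Q : finGroupType) (f : UMagmaMorphism.type G Q), f g <> 1.

End GroupProperties.

Section GeneralLinear.
Variables (k : nat) (K : fieldType).
Local Open Scope ring_scope.

(** The finite-field ['GL_k(p)] of the library forces [k > 0] and a finite
    coefficient ring, hence this version for arbitrary fields. *)
Definition GL := {A : 'M[K]_k | A \in unitmx}.
HB.instance Definition _ := Choice.on GL.

Definition GL_one : GL := Sub 1%:M (unitmx1 K k).
Fact GL_mul_subproof (A B : GL) : val A *m val B \in unitmx.
Proof. by rewrite unitmx_mul (valP A) (valP B). Qed.
Definition GL_mul (A B : GL) : GL := Sub (val A *m val B) (GL_mul_subproof A B).
Fact GL_inv_subproof (A : GL) : invmx (val A) \in unitmx.
Proof. by rewrite unitmx_inv (valP A). Qed.
Definition GL_inv (A : GL) : GL := Sub (invmx (val A)) (GL_inv_subproof A).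

Fact GL_mulA : associative GL_mul.
Proof. by move=> A B C; apply: val_inj; rewrite /= mulmxA. Qed.
Fact GL_mul1 : left_id GL_one GL_mul.
Proof. by move=> A; apply: val_inj; rewrite /= mul1mx. Qed.
Fact GL_mulr1 : right_id GL_one GL_mul.
Proof. by move=> A; apply: val_inj; rewrite /= mulmx1. Qed.
Fact GL_mulV : left_inverse GL_one GL_inv GL_mul.
Proof. by move=> A; apply: val_inj; rewrite /= mulVmx ?(valP A). Qed.
Fact GL_mulrV : right_inverse GL_one GL_inv GL_mul.
Proof. by move=> A; apply: val_inj; rewrite /= mulmxV ?(valP A). Qed.

HB.instance Definition _ := isGroup.Build GL
  GL_mulA GL_mul1 GL_mulr1 GL_mulV GL_mulrV.

End GeneralLinear.

Definition linear_in_char0 (G : groupType) : Prop :=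
  exists (k : nat) (K : fieldType),
    [pchar K]%R =i pred0 /\
    exists f : UMagmaMorphism.type G (GL k K), injective f.

(** The generator [a_(i+1)] is indexed by [i : 'I_l]. *)
Definition power_prod (l : nat) (n : int) : word 'I_l :=
  flatten [seq wpow i n | i <- enum 'I_l].

Definition square_relators (l : nat) : set (word 'I_l) :=
  range (fun n : int => power_prod l n ++ power_prod l n).

Definition Gl (l : nat) : groupType := presented (@square_relators l).

(* Main.v *)
Require Import Defs.
From HB Require Import structures.
From mathcomp Require Import all_boot all_order all_fingroup all_algebra.
From mathcomp Require Import all_classical.
From mathcomp Require Import cyclic mxtens.

(** Write [p_n = a_1^n a_2^n], [q_n = a_3^n a_4^n], [s_n] for the product of the
    other [n]-th powers, and [u_n = p_n q_n s_n], so that the relators of the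
    group [G] are the squares of the [u_n].

    Some finite quotients of [G], extensions of Heisenberg groups, send every
    [u_n] with [n] nonzero modulo [m] to one central involution
    ([heisenberg_quotient]).  Hence [u_n] has order exactly [2] for [n <> 0].  A
    subgroup of finite index contains a power of each generator, so it contains
    some [u_N] and has torsion.  In a linear representation of characteristic
    zero, the trace of [u_n] is an exponential sequence in [n] ([expGL_blk]); as
    the trace of an involution it takes finitely many values, so it returns to
    its value at [n = 0], which is the dimension ([expseq_finite_range]).  But an
    involution whose trace is the dimension is the identity.

    For the two other claims, [G] is an HNN extension.  The [p_n] and [u_n] with
    [n <> 0] and the [a_i] with [i >= 5] generate a subgroup [A], the free product
    of the cyclic groups that they generate; it contains
    [q_n = p_n^-1 u_n s_n^-1].  The identity [p_(n+1) = a_1 p_n a_2] amounts to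
    [a_1 p_n a_1^-1 = p_(n+1) p_1^-1], so [a_1] normalises the subgroup [M] of the
    [p_n]; in the same way [a_3] normalises the subgroup [M'] of the [q_n].  So
    [G] is [A] with two stable letters [a_1] and [a_3] that act on [M] and [M'] by
    automorphisms, and [M] and [M'] are retracts of [A].

    Nothing of this has to be proved beforehand: it suffices to find finite
    quotients of [G] in which a word that admits no cancellation survives.
    First, a reduced word of [A] is detected by permutations that move a point
    along the word ([reduced_word_perms]); they can be chosen to make the [p_n]
    and [u_n] periodic in [n].  Next, consider all periodic choices of
    permutations of a fixed finite set ([data]).  The automorphisms of [M] and
    [M'] permute them ([shift_data]), so on all choices at once the stable
    letters act by permutations too.  Precomposition with the retractions maps
    periodic choices to periodic choices ([retract_data]), hence the resulting
    finite quotient [B] of [A] still separates given elements from [M] and [M']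
    ([stab_group_retract]).  Finally, copies of [B] are arranged in levels, and
    the stable letters are corrected by permutations that commute with the images
    of [M] and [M'], in such a way that a reduced word with [N] stable letters
    climbs from level [0] to level [N] ([finite_HNN_path]).

    Since every element of [G] has a reduced expression, [G] is residually finite
    ([Gl_residually_finite]).  All positive powers of a cyclically reduced
    expression are reduced, so a nontrivial element of finite order is conjugate
    to some [u_n] with [n <> 0] ([torsion_conj_involution]).  All of these have
    the same central involution as image in a suitable Heisenberg quotient, so
    the product of two of them is not one of them; hence a finite subgroup has at
    most one nontrivial element. *)

Set Implicit Arguments.
Unset Strict Implicit.
Unset Printing Implicit Defensive.

Import Order.TTheory GRing.Theory.
Local Open Scope group_scope.

(** * Integer powers and the presentation *)
Definition zexp (G : groupType) (x : G) (n : int) : G :=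
  match n with Posz m => x ^+ m | Negz m => x ^- m.+1 end.

Section IntegerPowers.
Variable G : groupType.
Implicit Types x y : G.

Lemma zexp0 x : zexp x 0%R = 1. Proof. by []. Qed.

Lemma zexpS x n : zexp x (n + 1)%R = x * zexp x n.
Proof.
case: n => [n|[|n]]; rewrite /zexp.
- by rewrite -PoszD addn1 expgS.
- by rewrite expg1 mulgV.
have -> : (Negz n.+1 + 1)%R = Negz n by rewrite !NegzE -addn1 PoszD opprD subrK.
by rewrite (expgSr x n.+1) invgM mulVKg.
Qed.

Lemma zexpSr x n : zexp x (n + 1)%R = zexp x n * x.
Proof.
case: n => [n|[|n]]; rewrite /zexp.
- by rewrite -PoszD addn1 expgSr.
- by rewrite expg1 mulVg.
have -> : (Negz n.+1 + 1)%R = Negz n by rewrite !NegzE -addn1 PoszD opprD subrK.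
by rewrite (expgS x n.+1) invgM mulgVK.
Qed.

Lemma int_shift_ind (P : int -> Prop) :
  P 0%R -> (forall n, P n <-> P (n + 1)%R) -> forall n, P n.
Proof.
move=> P0 PS; elim/int_rect => // n IH; first by rewrite -addn1 PoszD -PS.
by apply/PS; rewrite -addn1 PoszD opprD subrK.
Qed.

Lemma zexp1 n : zexp (1 : G) n = 1.
Proof. by case: n => n; rewrite /zexp expg1n ?invg1. Qed.

Lemma zexpJ x y n : zexp (x ^ y) n = zexp x n ^ y.
Proof. by case: n => n; rewrite /zexp -conjXg ?conjVg. Qed.

Lemma zexpV x n : zexp x^-1 n = (zexp x n)^-1.
Proof. by case: n => n; rewrite /zexp expVgn. Qed.

(** A one-step recursion determines all the products [a^n b^n]; both inside the
    group and in its finite quotients, it is this recursion that gets checked. *)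
Lemma zexp_mul_telescope (a b : G) (p : int -> G) :
  p 0%R = 1 -> (forall n, p (n + 1)%R = a * p n * b) ->
  forall n, zexp a n * zexp b n = p n.
Proof.
move=> p0 pS; elim/int_shift_ind => [|n]; first by rewrite mulg1 p0.
rewrite zexpS zexpSr pS.
have -> : a * zexp a n * (zexp b n * b) = a * (zexp a n * zexp b n) * b.
  by rewrite !mulgA.
by split=> [->//|/mulIg/mulgI].
Qed.

End IntegerPowers.

Lemma gmulf_zexp (G H : groupType) (f : UMagmaMorphism.type G H) x n :
  f (zexp x n) = zexp (f x) n.
Proof. by case: n => n; rewrite /zexp ?gmulfV gmulfXn. Qed.

Lemma weval_cat (I : choiceType) (H : groupType) (f : I -> H) u v :
  weval f (u ++ v) = weval f u * weval f v.
Proof. by rewrite /weval big_cat. Qed.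

Lemma weval_wpow (I : choiceType) (H : groupType) (f : I -> H) x n :
  weval f (wpow x n) = zexp (f x) n.
Proof.
case: n => n; rewrite /weval /wpow /zexp big_nseq iter_mulg_1 //.
by rewrite expVgn.
Qed.

Lemma weval_power_prod l (H : groupType) (f : 'I_l -> H) n :
  weval f (power_prod l n) = \prod_(i < l) zexp (f i) n.
Proof.
rewrite /weval /power_prod big_flatten big_map enumT [index_enum _]unlock.
by apply: eq_bigr => i _; apply: weval_wpow.
Qed.

Definition ocons T n (x : T) (f : 'I_n -> T) (i : 'I_n.+1) : T :=
  oapp f x (unlift ord0 i).

Lemma ocons0 T n (x : T) (f : 'I_n -> T) : ocons x f ord0 = x.
Proof. by rewrite /ocons unlift_none. Qed.

Lemma oconsS T n (x : T) (f : 'I_n -> T) i : ocons x f (lift ord0 i) = f i.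
Proof. by rewrite /ocons liftK. Qed.

Lemma prod_ocons (H : groupType) n (x : H) (f : 'I_n -> H) k :
  \prod_(i < n.+1) zexp (ocons x f i) k = zexp x k * \prod_(i < n) zexp (f i) k.
Proof.
rewrite big_ord_recl ocons0; congr (_ * _).
by apply: eq_bigr => i _; rewrite oconsS.
Qed.

(** The square root of the [n]-th relator.  The first four factors are grouped in
    pairs since [a^n b^n] and [c^n d^n] will play symmetric parts. *)
Definition blk (H : groupType) l (a b c d : H) (e : 'I_l -> H) n :=
  zexp a n * zexp b n * (zexp c n * zexp d n) * \prod_i zexp (e i) n.

Section Generators.
Variable l : nat.
Let G := Gl l.+4.

Definition gens : 'I_l.+4 -> G := @pres_gen _ _.
Definition ga : G := gens ord0.
Definition gb : G := gens (lift ord0 ord0).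
Definition gc : G := gens (lift ord0 (lift ord0 ord0)).
Definition gd : G := gens (lift ord0 (lift ord0 (lift ord0 ord0))).
Definition ge (i : 'I_l) : G :=
  gens (lift ord0 (lift ord0 (lift ord0 (lift ord0 i)))).

Lemma pres_class_weval u : pres_class _ u = weval gens u :> G.
Proof.
elim: u => [|[x b] u IHu]; first by rewrite /weval big_nil.
rewrite -cat1s [LHS](pres_classM _ [:: (x, b)] u) IHu weval_cat; congr (_ * _).
rewrite /weval big_seq1 /=; case: b => //.
by rewrite /gens pres_genV.
Qed.

Lemma Gl_rel n : blk ga gb gc gd ge n ^+ 2 = 1.
Proof.
have: pres_class _ (power_prod l.+4 n ++ power_prod l.+4 n) = 1 :> G.
  by apply/pres_classP/WRel; exists n.
rewrite pres_class_weval weval_cat weval_power_prod !big_ord_recl.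
by rewrite -expg2 /blk !mulgA.
Qed.

Lemma Gl_hom (H : groupType) (a b c d : H) (e : 'I_l -> H) :
  (forall n, blk a b c d e n ^+ 2 = 1) ->
  exists phi : UMagmaMorphism.type G H,
    [/\ phi ga = a, phi gb = b, phi gc = c, phi gd = d & forall i, phi (ge i) = e i].
Proof.
move=> rel; pose f := ocons a (ocons b (ocons c (ocons d e))).
have [r [n _ <-]|phi phiE] := @pres_universal _ (@square_relators l.+4) H f.
  rewrite weval_cat weval_power_prod /f !prod_ocons -expg2 -[RHS](rel n).
  by rewrite /blk !mulgA.
by exists phi; split=> [||||i]; rewrite phiE /f ?oconsS ?ocons0.
Qed.

Lemma Gl_ind (P : G -> Prop) :
  P 1 -> (forall x y, P x -> P y -> P (x * y)) -> (forall x, P x -> P x^-1) ->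
  P ga -> P gb -> P gc -> P gd -> (forall i, P (ge i)) -> forall g, P g.
Proof.
move=> P1 PM PV Pa Pb Pc Pd Pe g.
have Pgen i : P (gens i).
  case: (unliftP ord0 i) => [{}i|]->; last exact: Pa.
  case: (unliftP ord0 i) => [{}i|]->; last exact: Pb.
  case: (unliftP ord0 i) => [{}i|]->; last exact: Pc.
  case: (unliftP ord0 i) => [{}i|]->; [exact: Pe|exact: Pd].
have [u ->] := pres_class_surj g; rewrite pres_class_weval /weval.
elim: u => [|[i b] u IHu]; rewrite ?big_nil ?big_cons //=.
by apply: PM IHu; case: b => //; apply: PV.
Qed.

End Generators.

(** * The Heisenberg quotients *)
Lemma residue_eq0 m (n : int) :
  (`|n| < m.+2)%N -> (n%:~R == 0 :> 'I_m.+2)%R = (n == 0%R).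
Proof.
move=> n_lt; have nat0 k : (k < m.+2)%N -> (k%:R == 0 :> 'I_m.+2)%R = (k == 0).
  move=> k_lt; rewrite -[in RHS](modn_small k_lt) -(val_Zp_nat (isT : 1 < m.+2)%N).
  by rewrite -val_eqE.
case: n n_lt => n n_lt; first exact: nat0.
by rewrite NegzE mulrNz oppr_eq0 nat0.
Qed.

Section HeisenbergQuotient.
Variable m : nat.
Let Z := 'I_m.+2.
Let T := ({ffun Z -> bool} * bool)%type.

(** Points are subsets of the integers modulo [m.+2] with a sign.  [hflip] and
    [htrans] are opposite halves of a Heisenberg group: a coordinate function
    and the translation by the set of nonzero residues. *)
Definition hshift_fun (i : Z) (y : T) : T := ([ffun k => y.1 (k + i)%R], y.2).
Definition hflip_fun (y : T) : T := (y.1, y.2 (+) y.1 0%R).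
Definition htrans_fun (y : T) : T := ([ffun k => y.1 k (+) (k != 0%R)], y.2).
Definition hneg_fun (y : T) : T := (y.1, ~~ y.2).

Fact hshift_inj i : injective (hshift_fun i).
Proof.
apply: (can_inj (g := hshift_fun (- i)%R)) => -[S c]; congr (_, _).
by apply/ffunP => k; rewrite !ffunE subrK.
Qed.
Fact hflip_inj : injective hflip_fun.
Proof. by apply: (can_inj (g := hflip_fun)) => -[S c]; rewrite /hflip_fun /= addbK. Qed.
Fact htrans_inj : injective htrans_fun.
Proof.
apply: (can_inj (g := htrans_fun)) => -[S c]; congr (_, _).
by apply/ffunP => k; rewrite !ffunE addbK.
Qed.
Fact hneg_inj : injective hneg_fun.
Proof. by apply: (can_inj (g := hneg_fun)) => -[S c]; rewrite /hneg_fun /= negbK. Qed.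

Definition hshift i : {perm T} := perm (@hshift_inj i).
Definition hflip : {perm T} := perm hflip_inj.
Definition htrans : {perm T} := perm htrans_inj.
Definition hneg : {perm T} := perm hneg_inj.

Lemma zexp_hshift n : zexp (hshift 1%R) n = hshift n%:~R%R.
Proof.
have hshiftD i j : hshift (i + j)%R = hshift i * hshift j.
  apply/permP => -[S c]; rewrite permM !permE; congr (_, _).
  by apply/ffunP => k; rewrite !ffunE addrA addrAC.
elim/int_shift_ind: n => [|n].
  rewrite zexp0; apply/permP => -[S c]; rewrite perm1 permE; congr (_, _).
  by apply/ffunP => k; rewrite !ffunE addr0.
rewrite zexpS rmorphD /= addrC hshiftD.
by split=> [->//|/mulgI].
Qed.

Lemma hflip_htrans : commute hflip htrans.
Proof.
apply/permP => -[S c]; rewrite !permM !permE /hflip_fun /htrans_fun /= !ffunE.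
by rewrite eqxx addbF.
Qed.

Lemma hneg_central p :
  [\/ p = hshift 1%R, p = hflip | p = htrans] -> commute hneg p.
Proof.
by case=> ->; apply/permP => -[S c]; rewrite !permM !permE // /hneg_fun /hflip_fun /= ?addNb.
Qed.

(** The shifted flip reads the subset at [i], and the translation changes this
    membership exactly when [i] is nonzero, so the two commute up to a sign. *)
Lemma hflip_shift_htrans i (g := hshift i * hflip * (hshift i)^-1) :
  g * htrans = (if i == 0%R then 1 else hneg) * htrans * g.
Proof.
have gE y : g y = (y.1, y.2 (+) y.1 i).
  have -> : g y = (hshift i)^-1 (hflip (hshift i y)) by rewrite !permM.
  apply: (canLR (permK _)); rewrite !permE; case: y => S c.
  by rewrite /hflip_fun /hshift_fun /= !ffunE add0r.
clearbody g; apply/permP => -[S c]; rewrite !permM !gE !permE /= ?ffunE.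
case: (eqVneq i _) => [->|i0]; rewrite ?perm1 ?permE /= ?ffunE.
  by rewrite addbF.
by congr (_, _); case: c; case: (S i).
Qed.

Variable l : nat.

(** With [x = hshift 1], [g = hflip] and [h = htrans], take [x],
    [g x^-1 g^-1], [gh x (gh)^-1] and [h x^-1 h^-1] as images of the first four
    generators and [1] for the others.  As [g] and [h] commute, the product of
    the [n]-th powers collapses to the commutator of [x^n g x^-n] and [h]. *)
Lemma heisenberg_quotient :
  exists phi : UMagmaMorphism.type (Gl l.+4) {perm T},
    (forall g, commute hneg (phi g)) /\
    forall n, phi (blk (@ga l) (@gb l) (@gc l) (@gd l) (@ge l) n) =
              if (n%:~R == 0 :> Z)%R then 1 else hneg.
Proof.
pose x := hshift 1%R; pose g := hflip; pose h := htrans.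
pose b := x^-1 ^ g^-1; pose c := x ^ (g * h)^-1; pose d := x^-1 ^ h^-1.
have blkE n : blk x b c d (fun _ : 'I_l => 1) n =
              if (n%:~R == 0 :> Z)%R then 1 else hneg.
  rewrite /blk big1 ?mulg1 => [|i _]; last exact: zexp1.
  rewrite /b /c /d !zexpJ !zexpV zexp_hshift.
  have := hflip_shift_htrans n%:~R%R; set X := hshift _; set z := if _ then _ else _.
  rewrite -/g -/h => gh.
  have hg : h^-1 * g^-1 * h = g^-1.
    by rewrite -invgM [g * h]hflip_htrans invgM mulgVK.
  have -> : z = X * g * X^-1 * h * (X * g * X^-1)^-1 * h^-1 by rewrite gh !mulgK.
  rewrite !conjgE !invgM !invgK !mulgA mulgVK.
  by rewrite -[in RHS]hg !mulgA.
have [|phi [pa pb pc pd pe]] := @Gl_hom l _ x b c d (fun=> 1).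
  move=> n; rewrite blkE; case: ifP => _; first exact: expg1n.
  apply/permP => -[S k]; rewrite expg2 permM perm1 !permE.
  by rewrite /hneg_fun /= negbK.
have zx : commute hneg x by apply: hneg_central; constructor 1.
have zg : commute hneg g by apply: hneg_central; constructor 2.
have zh : commute hneg h by apply: hneg_central; constructor 3.
exists phi; split.
  elim/Gl_ind; rewrite ?gmulf1 ?pa ?pb ?pc ?pd.
  - exact: commute1.
  - by move=> u v cu cv; rewrite gmulfM; apply: commuteM.
  - by move=> u cu; rewrite gmulfV; apply: commuteV.
  - by [].
  - by rewrite /b conjgE; do ![apply: commuteM | apply: commuteV].
  - by rewrite /c conjgE; do ![apply: commuteM | apply: commuteV].
  - by rewrite /d conjgE; do ![apply: commuteM | apply: commuteV].
  - by move=> i; rewrite pe; apply: commute1.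
move=> n; rewrite -blkE /blk !gmulfM !gmulf_zexp pa pb pc pd gmulf_prod.
by congr (_ * _); apply: eq_bigr => i _; rewrite gmulf_zexp pe.
Qed.

End HeisenbergQuotient.

(** * Failure of virtual torsion-freeness *)
Section NotVirtuallyTorsionFree.
Variable l : nat.
Let G := Gl l.+4.
Definition gu : int -> G := blk (@ga l) (@gb l) (@gc l) (@gd l) (@ge l).

Lemma gu_neq1 n : n != 0%R -> gu n <> 1.
Proof.
move=> n0 gu1; have [phi [_ phiu]] := heisenberg_quotient `|n|%N l.
have := phiu n; rewrite -/(gu n) gu1 gmulf1 residue_eq0 1?leqW // (negPf n0).
by move/permP/(_ ([ffun=> false], false)); rewrite perm1 permE.
Qed.

End NotVirtuallyTorsionFree.

Section FiniteIndex.
Local Open Scope classical_set_scope.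

(** Two powers of [x] lie in the same coset of [H]. *)
Lemma finite_index_power (G : groupType) (H : groupClosed G) (x : G) :
  finite_index H -> exists2 k, (0 < k)%N & x ^+ k \in H.
Proof.
move=> fin; apply: contrapT => noK.
pose coset (y : G) := [set y * h | h in [set` H]].
have coset_inj : injective (fun i => coset (x ^+ i)).
  suff lt_neq i j : (i < j)%N -> coset (x ^+ i) <> coset (x ^+ j).
    by move=> i j ij; case: (ltngtP i j) => // /lt_neq; rewrite ij.
  move=> ij eq_ij; apply: noK; exists (j - i)%N; first by rewrite subn_gt0.
  have: coset (x ^+ j) (x ^+ j) by exists 1; rewrite ?mulg1 //= gpred1.
  rewrite -eq_ij => -[h Hh]; rewrite -{1}(subnKC (ltnW ij)) expgnDr => /mulgI <-.
  exact: Hh.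
apply: infinite_nat.
rewrite (_ : setT = (fun i => coset (x ^+ i)) @^-1` range coset).
  by apply: finite_preimage => // i j _ _; apply: coset_inj.
by apply/seteqP; split=> // i _; exists (x ^+ i).
Qed.

End FiniteIndex.

Lemma Gl_not_virtually_torsion_free l : ~ virtually_torsion_free (Gl l.+4).
Proof.
move=> [H [fin tf]].
have /choice[k kP] x : exists k, (0 < k)%N /\ x ^+ k \in H.
  by have [k] := finite_index_power x fin; exists k.
have powH x N : (k x %| N)%N -> zexp x N \in H.
  by case/dvdnP=> q ->; rewrite /zexp mulnC expgnA gpredXn // (kP x).2.
pose N := (k (@ga l) * k (@gb l) * k (@gc l) * k (@gd l) * \prod_i k (@ge l i))%N.
have N_gt0 : (0 < N)%N.
  by rewrite /N !muln_gt0 !(fun x => (kP x).1) /=; apply: prodn_gt0 => i; exact: (kP _).1.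
have uH : gu l N \in H.
  rewrite /gu /blk !gpredM //; try apply: powH.
  - by rewrite /N -!mulnA dvdn_mulr.
  - by rewrite /N (mulnC (k (@ga l))) -!mulnA dvdn_mulr.
  - by rewrite /N -!mulnA dvdn_mull // dvdn_mull // dvdn_mulr.
  - by rewrite /N -!mulnA 3?dvdn_mull // dvdn_mulr.
  elim/big_ind: _ => [|x y Hx Hy|i _]; rewrite ?gpred1 ?gpredM //.
  by apply: powH; rewrite /N dvdn_mull // (bigD1 i) //= dvdn_mulr.
have u2 : gu l N ^+ 2 = 1 by apply: Gl_rel.
have := tf _ 2 uH isT u2; apply: gu_neq1.
by rewrite eqz_nat -lt0n.
Qed.

(** * Exponential sequences and linear representations *)
Section ExponentialSequences.
Variable K : fieldType.
Local Open Scope ring_scope.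

(** Invertibility of [M] makes the recurrence of [s] reversible, so that a
    repetition in [s] propagates down to the index [0]. *)
Definition expseq (s : nat -> K) : Prop :=
  exists (D : nat) (M : 'M[K]_D) (u : 'rV_D) (w : nat -> 'cV_D),
    [/\ M \in unitmx, forall n, w n.+1 = M *m w n
      & forall n, s n = (u *m w n) 0 0].

Lemma expseq_const c : expseq (fun=> c).
Proof.
exists 1%N, 1%:M, c%:M, (fun=> 1%:M); split=> [|n|n].
- exact: unitmx1.
- by rewrite mulmx1.
- by rewrite mulmx1 mxE eqxx.
Qed.

Lemma expseqD s t : expseq s -> expseq t -> expseq (fun n => s n + t n).
Proof.
move=> [D [M [u [w [Mu wS sE]]]]] [D' [M' [u' [w' [Mu' wS' tE]]]]].
exists (D + D')%N, (block_mx M 0 0 M'), (row_mx u u').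
exists (fun n => col_mx (w n) (w' n)); split=> [|n|n].
- by move: Mu Mu'; rewrite !unitmxE det_ublock => Mu Mu'; rewrite unitrM Mu.
- by rewrite mul_block_col !mul0mx addr0 add0r wS wS'.
- by rewrite mul_row_col mxE sE tE.
Qed.

(** The tensor product of the two recurrent vectors computes the product. *)
Lemma expseqM s t : expseq s -> expseq t -> expseq (fun n => s n * t n).
Proof.
move=> [[|D] [M [u [w [Mu wS sE]]]]] [D' [M' [u' [w' [Mu' wS' tE]]]]].
  have -> : (fun n => s n * t n) = (fun=> 0).
    by apply/funext => n; rewrite sE thinmx0 mul0mx mxE mul0r.
  exact: expseq_const.
case: D' => [|D'] in M' u' w' Mu' wS' tE *.
  have -> : (fun n => s n * t n) = (fun=> 0).
    by apply/funext => n; rewrite tE [u']thinmx0 mul0mx mxE mulr0.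
  exact: expseq_const.
exists (D.+1 * D'.+1)%N, (tensmx M M'), (tensmx u u').
exists (fun n => tensmx (w n) (w' n)); split=> [|n|n].
- exact: tensmx_unit.
- by rewrite /= wS wS'; exact: (esym (tensmx_mul M M' (w n) (w' n))).
- have := congr1 (fun X : 'M_1 => X 0 0) (tensmx_mul u u' (w n) (w' n)).
  by rewrite sE tE => /= ->; rewrite [RHS]mxE !ord1.
Qed.

Lemma expseq_sum (I : finType) (s : I -> nat -> K) :
  (forall i, expseq (s i)) -> expseq (fun n => \sum_i s i n).
Proof.
move=> sE; elim: (index_enum I) => [|i r IHr].
  under [X in expseq X]funext do rewrite big_nil; exact: expseq_const.
by under [X in expseq X]funext do rewrite big_cons; apply: expseqD.
Qed.

Lemma expseq_recurrence s :
  expseq s -> exists (D : nat) (c : nat -> K),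
    c 0%N != 0 /\ forall n, \sum_(i < D.+1) c i * s (i + n)%N = 0.
Proof.
move=> [[|D] [M [u [w [Mu wS sE]]]]].
  exists 0%N, (fun=> 1); split=> [|n]; first exact: oner_neq0.
  by rewrite big_ord1 mul1r sE [u]thinmx0 mul0mx mxE.
exists D.+1, (fun i => (char_poly M)`_i); split=> [|n].
  rewrite char_poly_det mulf_neq0 ?signr_eq0 //.
  by rewrite -unitfE -unitmxE.
have wE i : w (i + n)%N = M ^+ i *m w n.
  elim: i => [|i IHi]; first by rewrite expr0 mul1mx.
  by rewrite addSn wS IHi mulmxA exprS.
have := Cayley_Hamilton M.
rewrite -[X in horner_mx _ X]coefK poly_def size_char_poly linear_sum /=.
move/(congr1 (fun X => (u *m (X *m w n)) 0 0)).
rewrite mul0mx mulmx0 [RHS]mxE => CH; rewrite -[RHS]CH mulmx_suml mulmx_sumr.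
rewrite summxE; apply: eq_bigr => i _.
by rewrite linearZ /= rmorphXn /= horner_mx_X -scalemxAl -scalemxAr mxE sE wE.
Qed.

(** Among the windows of [D] consecutive values two coincide; since the lowest
    coefficient of the recurrence does not vanish, it can be run backwards until
    the first window starts at [0]. *)
Lemma expseq_finite_range s (S : seq K) :
  expseq s -> (forall n, s n \in S) -> exists2 p, (0 < p)%N & s p = s 0%N.
Proof.
move=> /expseq_recurrence[D [c [c0 rec]]] sS.
have [n [m [m_gt0 eq_nm]]] : exists n m, (0 < m)%N /\
    forall j, (j < D)%N -> s (n + j)%N = s (m + n + j)%N.
  pose state n : D.-tuple (seq_sub S) := [tuple SeqSub (sS (n + j)%N) | j < D].
  have /injectivePn[x [y xy eq_xy]] :
      ~~ injectiveb (fun x : 'I_(#|{: D.-tuple (seq_sub S)}|.+1) => state x).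
    by apply/negP => /injectiveP/leq_card; rewrite card_ord ltnn.
  wlog lt_xy : x y xy eq_xy / (x < y)%N.
    move=> IH; case: (ltngtP x y) => [|yx|/val_inj] ; first exact: IH.
      by apply: (IH y x) => //; rewrite eq_sym.
    by move/eqP: xy.
  exists x, (y - x)%N; rewrite subn_gt0; split=> // j ltjD.
  have := congr1 (fun t => val (tnth t (Ordinal ltjD))) eq_xy.
  by rewrite !tnth_mktuple /= subnK // ltnW.
exists m => //; elim: n eq_nm => [|n IHn] eq_nm.
  case: D rec eq_nm => [|D] rec eq_nm; last first.
    by have := eq_nm 0%N isT; rewrite !addn0.
  have s0 n : s n = 0.
    by have /eqP := rec n; rewrite big_ord1 mulf_eq0 (negPf c0) => /eqP.
  by rewrite !s0.
apply: IHn => -[_|j ltjD]; last first.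
  by have := eq_nm j (ltnW ltjD); rewrite !addnS !addSn.
have eqS (i : 'I_D) : s (bump 0 i + (m + n))%N = s (bump 0 i + n)%N.
  have := eq_nm i (ltn_ord i); rewrite /bump leq0n add1n !addnS !addSn.
  by rewrite (addnC i n) (addnC i (m + n)%N) => ->.
have := etrans (rec (m + n)%N) (esym (rec n)).
rewrite !big_ord_recl /= !add0n.
under eq_bigr do rewrite eqS.
by move=> /addIr/(mulfI c0); rewrite !addn0.
Qed.

(** In a full rank factorisation [E = C R], idempotence means [R C = 1]. *)
Lemma mxtrace_idempotent k (E : 'M[K]_k) : E *m E = E -> \tr E = (\rank E)%:R.
Proof.
move=> EE; have E_base := mulmx_base E.
have RC : row_base E *m col_base E = 1%:M.
  apply: (row_free_inj (row_base_free E)); rewrite mul1mx.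
  apply: (row_full_inj (col_base_full E)).
  by rewrite mulmxA mulmxA E_base -mulmxA E_base EE.
by rewrite -{1}E_base mxtrace_mulC RC mxtrace1.
Qed.

Section Involutions.
Hypothesis K_char0 : [pchar K] =i pred0.
Variables (k : nat) (P : 'M[K]_k).
Hypothesis PP : P *m P = 1%:M.

Let natr_neq0 n : (n.+1%:R != 0 :> K).
Proof. by have /pcharf0P-> := K_char0. Qed.

(** [P = 1 - 2 E] with [E] idempotent, and [r] is the rank of [E]. *)
Lemma mxtrace_involution :
  exists2 r, (r <= k)%N & \tr P = k%:R - r.*2%:R /\ (r = 0%N -> P = 1%:M).
Proof.
pose E := 2%:R^-1 *: (1%:M - P).
have EE : E *m E = E.
  rewrite /E -scalemxAl -scalemxAr mulmxBl mul1mx mulmxBr mulmx1 PP opprB.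
  have -> : 1%:M - P + (1%:M - P) = 2%:R *: (1%:M - P).
    by rewrite -mulr2n scaler_nat.
  by rewrite (scalerA _ 2%:R) mulVf ?scale1r //; apply: natr_neq0.
have PE : P = 1%:M - 2%:R *: E.
  by rewrite /E scalerA mulfV // scale1r subKr.
exists (\rank E); first exact: rank_leq_row; split.
  rewrite {1}PE raddfB /= mxtrace1 linearZ /= mxtrace_idempotent //.
  by rewrite -muln2 mulnC natrM.
by move/eqP; rewrite mxrank_eq0 => /eqP E0; rewrite PE E0 scaler0 subr0.
Qed.

Lemma mxtrace_involution1 : \tr P = k%:R -> P = 1%:M.
Proof.
have [r _ [-> ]] := mxtrace_involution; case: r => [|r] P1 /eqP; first by rewrite P1.
by rewrite subr_eq addrC -subr_eq subrr eq_sym (negPf (natr_neq0 _)).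
Qed.

End Involutions.
End ExponentialSequences.

Section NotLinear.
Variables (k : nat) (K : fieldType).
Local Open Scope ring_scope.

Definition expGL (x : nat -> GL k K) : Prop :=
  forall i j, expseq (fun n => val (x n) i j).

Lemma expGL_const x : expGL (fun=> x).
Proof. by move=> i j; apply: expseq_const. Qed.

Lemma expGL_mul x y : expGL x -> expGL y -> expGL (fun n => x n * y n)%g.
Proof.
move=> ex ey i j; under [X in expseq X]funext => n do rewrite [val _]/= mxE.
by apply: expseq_sum => h; apply: expseqM.
Qed.

Lemma expGL_pow x : expGL (fun n => x ^+ n)%g.
Proof.
move=> i j; exists k, (val x), (delta_mx 0 i), (fun n => val (x ^+ n)%g *m delta_mx j 0).
split=> [|n|n]; first exact: valP.
  by rewrite expgS mulmxA.
by rewrite mulmxA -rowE -colE !mxE.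
Qed.

Lemma expGL_prod l (x : 'I_l -> nat -> GL k K) :
  (forall i, expGL (x i)) -> expGL (fun n => \prod_i x i n)%g.
Proof.
move=> ex; elim: (index_enum _) => [|i r IHr].
  under [X in expGL X]funext do rewrite big_nil; exact: expGL_const.
by under [X in expGL X]funext do rewrite big_cons; apply: expGL_mul.
Qed.

Lemma expGL_blk l (a b c d : GL k K) (e : 'I_l -> GL k K) :
  expGL (fun n => blk a b c d e n%:Z).
Proof.
apply: expGL_mul; last by apply: expGL_prod => i; apply: expGL_pow.
by do 2![apply: expGL_mul]; apply: expGL_pow.
Qed.

End NotLinear.

(** The traces of the images of the [gu n] lie in a finite set, so one with
    [n > 0] equals the trace at [n = 0]; that involution is then trivial, which
    contradicts [gu_neq1]. *)
Lemma Gl_not_linear l : ~ linear_in_char0 (Gl l.+4).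
Proof.
move=> [k [K [K_char0 [f f_inj]]]].
pose s (n : nat) := (\tr (val (f (gu l n%:Z))))%R.
have fu2 n : (val (f (gu l n)) *m val (f (gu l n)) = 1%:M)%R.
  have := congr1 f (Gl_rel l n); rewrite expg2 gmulfM gmulf1.
  by move/(congr1 val).
have s_exp : expseq s.
  apply: expseq_sum => i.
  have -> : (fun n : nat => val (f (gu l n%:Z)) i i) =
     (fun n : nat => val (blk (f (ga l)) (f (gb l)) (f (gc l)) (f (gd l)) (f \o @ge l) n%:Z) i i).
    apply/funext => n; suff -> : f (gu l n) =
        blk (f (ga l)) (f (gb l)) (f (gc l)) (f (gd l)) (f \o @ge l) n by [].
    rewrite /gu /blk !gmulfM !gmulf_zexp gmulf_prod.
    by congr (_ * _)%g; apply: eq_bigr => j _; rewrite gmulf_zexp.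
  exact: expGL_blk.
have sS n : s n \in [seq (k%:R - r.*2%:R : K)%R | r <- iota 0 k.+1].
  have [r rk [sE _]] := mxtrace_involution K_char0 (fu2 n).
  by apply/mapP; exists r; rewrite // mem_iota ltnS.
have [p p_gt0 sp] := expseq_finite_range s_exp sS.
apply: (@gu_neq1 l p); first by rewrite eqz_nat -lt0n.
apply: f_inj; rewrite gmulf1; apply: val_inj.
apply: (mxtrace_involution1 K_char0 (fu2 p)).
rewrite -[LHS]/(s p) sp /s.
have -> : gu l 0%Z = 1%g.
  by rewrite /gu /blk !zexp0 !mulg1 big1 ?mulg1.
by rewrite gmulf1 mxtrace1.
Qed.

(** * Equivariant extension of partial permutations *)
Section FreeActions.
Variables (B : finGroupType) (Y : finType) (rho : B -> {perm Y}) (H : {group B}).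
Hypothesis rhoM : forall g h, rho (g * h) = rho g * rho h.
Hypothesis rho_free : forall h y, h \in H -> rho h y = y -> h = 1.

Definition same_orbit y y' := [exists h in H, rho h y == y'].

Lemma same_orbitP y y' :
  reflect (exists2 h, h \in H & rho h y = y') (same_orbit y y').
Proof. by apply: (iffP exists_inP) => -[h Hh /eqP]; exists h => //; apply/eqP. Qed.

Let rho1 : rho 1 = 1.
Proof. by apply: (mulgI (rho 1)); rewrite -rhoM !mulg1. Qed.

Let rhoV h y : rho h^-1 (rho h y) = y.
Proof. by rewrite -permM -rhoM mulgV rho1 perm1. Qed.

Lemma same_orbit_sym y y' : same_orbit y y' -> same_orbit y' y.
Proof.
by case/same_orbitP=> h Hh <-; apply/same_orbitP; exists h^-1; rewrite ?groupV.
Qed.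

Lemma same_orbit_trans y y' y'' :
  same_orbit y y' -> same_orbit y' y'' -> same_orbit y y''.
Proof.
case/same_orbitP=> h Hh <- /same_orbitP[k Hk <-]; apply/same_orbitP.
by exists (h * k); rewrite ?groupM // rhoM permM.
Qed.

(** The equivariant analogue of a transposition.  If [y] and [w] share an orbit,
    the first test shadows the second one, and the map is the equivariant
    bijection of this orbit that sends [y] to [w]. *)
Definition orbit_swap_fun y w x :=
  if [pick h in H | rho h y == x] is Some h then rho h w
  else if [pick h in H | rho h w == x] is Some h then rho h y else x.

Lemma orbit_swap_funl y w h :
  h \in H -> orbit_swap_fun y w (rho h y) = rho h w.
Proof.
move=> Hh; rewrite /orbit_swap_fun; case: pickP => [k /andP[Hk /eqP kh]|/(_ h)].
  suff /eqP : h * k^-1 = 1 by rewrite mulg_eq1 invgK => /eqP->.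
  by apply: (rho_free (y := y)); rewrite ?groupM ?groupV // rhoM permM -kh rhoV.
by rewrite Hh eqxx.
Qed.

Lemma orbit_swap_funr y w h :
  h \in H -> ~~ same_orbit y w -> orbit_swap_fun y w (rho h w) = rho h y.
Proof.
move=> Hh yw; rewrite /orbit_swap_fun; case: pickP => [k /andP[Hk /eqP kh]|_].
  case/negP: yw; apply/same_orbitP; exists (k * h^-1); rewrite ?groupM ?groupV //.
  by rewrite rhoM permM kh rhoV.
case: pickP => [k /andP[Hk /eqP kh]|/(_ h)]; last by rewrite Hh eqxx.
suff /eqP : h * k^-1 = 1 by rewrite mulg_eq1 invgK => /eqP->.
by apply: (rho_free (y := w)); rewrite ?groupM ?groupV // rhoM permM -kh rhoV.
Qed.

Lemma orbit_swap_fun_id y w x :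
  ~~ same_orbit y x -> ~~ same_orbit w x -> orbit_swap_fun y w x = x.
Proof.
move=> yx wx; rewrite /orbit_swap_fun; case: pickP => [k /andP[Hk kh]|_].
  by case/negP: yx; apply/exists_inP; exists k.
by case: pickP => [k /andP[Hk kh]|] //; case/negP: wx; apply/exists_inP; exists k.
Qed.

Variant orbit_swap_spec y w x : Y -> Prop :=
| OrbitSwapL h of h \in H & x = rho h y : orbit_swap_spec y w x (rho h w)
| OrbitSwapR h of h \in H & x = rho h w & ~~ same_orbit y w :
    orbit_swap_spec y w x (rho h y)
| OrbitSwapId of ~~ same_orbit y x & ~~ same_orbit w x : orbit_swap_spec y w x x.

Lemma orbit_swapP y w x : orbit_swap_spec y w x (orbit_swap_fun y w x).
Proof.
case: (boolP (same_orbit y x)) => [/same_orbitP[h Hh <-]|yx].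
  by rewrite orbit_swap_funl //; apply: OrbitSwapL Hh _.
case: (boolP (same_orbit w x)) => [/same_orbitP[h Hh wx]|wx]; last first.
  by rewrite orbit_swap_fun_id //; constructor 3.
have yw : ~~ same_orbit y w.
  by apply: contra yx => /same_orbit_trans; apply; apply/same_orbitP; exists h.
by rewrite -wx orbit_swap_funr //; apply: OrbitSwapR Hh _ yw.
Qed.

Lemma orbit_swap_funK y w : cancel (orbit_swap_fun y w) (orbit_swap_fun w y).
Proof.
move=> x; case: (orbit_swapP y w x) => [h Hh ->|h Hh -> yw|yx wx].
- exact: orbit_swap_funl.
- by apply: orbit_swap_funr => //; apply: contra yw; apply: same_orbit_sym.
- exact: orbit_swap_fun_id.
Qed.

Definition orbit_swap y w : {perm Y} := perm (can_inj (orbit_swap_funK y w)).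

Lemma orbit_swap_commute y w h : h \in H -> commute (orbit_swap y w) (rho h).
Proof.
move=> Hh; apply/permP => x; rewrite !permM !permE.
case: (orbit_swapP y w x) => [k Hk ->|k Hk -> yw|yx wx].
- by rewrite -!permM -!rhoM orbit_swap_funl ?groupM.
- by rewrite -!permM -!rhoM orbit_swap_funr ?groupM.
have orb_h : same_orbit x (rho h x) by apply/same_orbitP; exists h.
rewrite orbit_swap_fun_id //.
  by apply: contra yx => /same_orbit_trans; apply; apply: same_orbit_sym.
by apply: contra wx => /same_orbit_trans; apply; apply: same_orbit_sym.
Qed.

(** Add the prescribed values one at a time: composing with the swap of the
    orbits of [k y] and [w] sends [y] to [w], and it does not disturb the values
    already prescribed because these lie in other orbits. *)
Lemma equivariant_extension (C : seq (Y * Y)) :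
  pairwise (fun c d => ~~ same_orbit c.1 d.1 && ~~ same_orbit c.2 d.2) C ->
  exists2 k : {perm Y}, forall h, h \in H -> commute k (rho h)
                      & forall c, c \in C -> k c.1 = c.2.
Proof.
elim: C => [|[y w] C IHC] /=.
  by exists 1 => // h _; apply/esym/commute1.
case/andP=> /allP yC /IHC[k kC kE]; exists (k * orbit_swap (k y) w) => [h Hh|c].
  by apply/commute_sym/commuteM; apply/commute_sym; [apply: kC|apply: orbit_swap_commute].
rewrite inE permM permE => /predU1P[->|Cc] /=.
  by have := orbit_swap_funl (k y) w (group1 H); rewrite rho1 !perm1.
have /andP[/= yc wc] := yC c Cc; rewrite kE // orbit_swap_fun_id //.
apply: contra yc => /same_orbitP[h Hh]; rewrite -permM (kC h Hh) permM -kE //.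
by move/perm_inj=> <-; apply/same_orbitP; exists h.
Qed.

End FreeActions.

Lemma partial_perm_extension (Y : finType) (C : seq (Y * Y)) :
  pairwise (fun c d => (c.1 != d.1) && (c.2 != d.2)) C ->
  exists k : {perm Y}, forall c, c \in C -> k c.1 = c.2.
Proof.
move=> C_inj.
have same y y' : same_orbit id 1%G y y' = (y == y' :> Y).
  apply/same_orbitP/eqP => [[h /set1P-> ]|->]; first by rewrite perm1.
  by exists 1; rewrite ?perm1 ?group1.
have [//|h y /set1P//||k _ kC] := @equivariant_extension _ Y id 1%G _ _ C.
  by apply: sub_pairwise C_inj => c d; rewrite !same.
by exists k.
Qed.

(** * Climbing words in a finite HNN extension *)
Section FiniteHNN.
Variables (B : finGroupType) (H : bool -> {group B}) (x : bool -> B).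
Hypothesis xH : forall t, x t \in 'N(H t).
Variables (N : nat) (g : nat -> B) (s : nat -> bool * bool).
Hypothesis reduced : forall i, i.+1 < N ->
  s i.+1 = ((s i).1, ~~ (s i).2) -> g i.+1 \notin H (s i).1.

Let Y := (B * 'I_N.+1)%type.

Fact level_mul_inj h : injective (fun y : Y => (y.1 * h, y.2)).
Proof. by move=> [a i] [b j] [/mulIg-> ->]. Qed.
Definition level_mul h : {perm Y} := perm (@level_mul_inj h).

Lemma level_mul1 : level_mul 1 = 1.
Proof. by apply/permP => -[a i]; rewrite perm1 permE /= mulg1. Qed.

Lemma level_mulM g1 g2 : level_mul (g1 * g2) = level_mul g1 * level_mul g2.
Proof. by apply/permP => y; rewrite permM !permE /= mulgA. Qed.

HB.instance Definition _ := isUMagmaMorphism.Build B {perm Y} level_mul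
  (level_mul1, level_mulM).

Lemma level_mul_free h y : level_mul h y = y -> h = 1.
Proof.
rewrite permE; case: y => a i [ah]; apply: (mulgI a).
by rewrite ah mulg1.
Qed.

Definition stab_act (G : groupType) (tau : bool -> G) (e : bool * bool) : G :=
  if e.2 then (tau e.1)^-1 else tau e.1.

(** The permutation [level_mul (x t)] satisfies the conjugation relations, and it
    still does after composition with a permutation that commutes with
    [level_mul h] for all [h] in [H t].  The freedom in the latter is used to
    send the [i]-th point of the path from level [i] to level [i.+1].  The
    requirements are compatible since two of them can meet only at a common
    level, where the pair of opposite stable letters is separated by an element
    outside [H t]. *)
Lemma finite_HNN_path : exists tau : bool -> {perm Y},
  (forall t h, h \in H t -> level_mul h * tau t = tau t * level_mul (h ^ x t)) /\
  forall i, i < N -> stab_act tau (s i) (g i, inord i) = (1, inord i.+1).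
Proof.
pose pr i : Y * Y := let xV := (x (s i).1)^-1 in
  if (s i).2 then ((1, inord i.+1), (g i * xV, inord i))
  else ((g i, inord i), (xV, inord i.+1)).
have kapP t : exists k : {perm Y},
    (forall h, h \in H t -> commute k (level_mul h)) /\
    forall i, i < N -> (s i).1 = t -> k (pr i).1 = (pr i).2.
  have [||k kH kC] := @equivariant_extension B Y level_mul (H t)
    level_mulM _ [seq pr i | i <- iota 0 N & (s i).1 == t].
  - by move=> h y _; apply: level_mul_free.
  - rewrite pairwise_map.
    pose P i := (i < N) && ((s i).1 == t).
    apply: (@sub_in_pairwise _ P ltn) => [i j||].
    + move=> /andP[iN /eqP it] /andP[jN /eqP jt] ij.
      have key : (s i).2 = ~~ (s j).2 -> i.+1 = j -> g j \notin H t.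
        move=> sij iS; rewrite -iS -it; apply: reduced; first by rewrite iS.
        by rewrite iS it -jt sij negbK -surjective_pairing.
      have sameE (a b : B) u v : u <= N -> v <= N ->
          same_orbit level_mul (H t) (a, inord u) (b, inord v) ->
          u = v /\ a^-1 * b \in H t.
        move=> uN vN /same_orbitP[h Hh]; rewrite permE => -[<- /(congr1 val)].
        by rewrite /= !inordK ?ltnS // mulKg.
      have jneq : (j == i) = false by rewrite gtn_eqF.
      have jneqS : (i == j.+1) = false by rewrite ltn_eqF // ltnW.
      have [iW jW] := (ltnW iN, ltnW jN).
      rewrite /pr /= it jt; case Ei: (s i).2; case Ej: (s j).2 => /=;
        apply/andP; split; apply/negP => /sameE[//|//|] [].
      all: try by move=> /eqP; rewrite ?eqSS ?jneqS // eq_sym jneq.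
      + by move=> iS; rewrite invg1 mul1g; apply/negP/key; rewrite ?Ei ?Ej.
      + move=> iS; rewrite invgK; have/negP := key (etrans Ei (esym (congr1 negb Ej))) iS.
        by rewrite -(memJ_norm _ (groupVr (xH t))) conjgE invgK.
    + by apply/allP => i; rewrite mem_filter mem_iota andbC.
    rewrite -sorted_pairwise; last exact: ltn_trans.
    by rewrite sorted_filter ?iota_ltn_sorted //; apply: ltn_trans.
  exists k; split=> // i iN it; apply: (kC (pr i)); apply: map_f.
  by rewrite mem_filter it eqxx mem_iota.
have /choice[k kP] t := kapP t.
exists (fun t => k t * level_mul (x t)); split=> [t h Hh|i iN].
  rewrite mulgA -(kP t).1 // -!mulgA -!level_mulM; congr (_ * level_mul _).
  by rewrite -conjgC.
have := (kP (s i).1).2 i iN erefl; rewrite /pr /stab_act.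
case: (s i).2 => /= kE.
  by apply: (canLR (permK _)); rewrite permM kE permE /= mulgVK.
by rewrite permM kE permE /= mulVg.
Qed.

End FiniteHNN.

(** * Words in free products of cyclic groups *)
Section PathLemmas.
Variables (T : eqType) (e : rel T).

Lemma not_sortedP (s : seq T) :
  ~~ sorted e s -> exists s1 x y s2, s = s1 ++ x :: y :: s2 /\ ~~ e x y.
Proof.
case: s => //= x s; elim: s x => //= y s IHs x; rewrite negb_and.
have [exy /= /IHs[s1 [u [v [s2 [-> euv]]]]]|exy _] := boolP (e x y).
  by exists (x :: s1), u, v, s2.
by exists [::], x, y, s.
Qed.

Lemma sorted_flatten_nseq k (s : seq T) :
  path.cycle e s -> sorted e (flatten (nseq k s)).
Proof.
case: s => [_|x s]; first by elim: k.
rewrite /= rcons_path => /andP[xs esx].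
have xsk j : path e (last x s) (flatten (nseq j (x :: s))).
  by elim: j => //= j IHj; rewrite esx cat_path xs.
by case: k => //= k; rewrite cat_path xs xsk.
Qed.

End PathLemmas.

Section FreeProductWords.
Variables K J : eqType.

(** [inl (k, b)] is a free generator or its inverse, and [inr j] a generator of
    order two.  As the latter is its own formal inverse, one notion of reduced
    word covers both kinds of factors. *)
Definition letter := ((K * bool) + J)%type.
HB.instance Definition _ := Equality.on letter.

Definition linv (x : letter) : letter :=
  match x with inl (k, b) => inl (k, ~~ b) | inr j => inr j end.

Definition lwinv (w : seq letter) := rev (map linv w).

Definition lcompat : rel letter := fun x y => y != linv x.

Section Evaluation.
Variables (G : groupType) (P : K -> G) (U : J -> G).

Definition leval (x : letter) : G :=
  match x with inl (k, b) => if b then (P k)^-1 else P k | inr j => U j end.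

Definition lprod (w : seq letter) : G := \prod_(x <- w) leval x.

Lemma lprod_nil : lprod [::] = 1. Proof. exact: big_nil. Qed.
Lemma lprod_cons x w : lprod (x :: w) = leval x * lprod w.
Proof. exact: big_cons. Qed.
Lemma lprod_cat u v : lprod (u ++ v) = lprod u * lprod v.
Proof. exact: big_cat. Qed.
Lemma lprod_seq1 x : lprod [:: x] = leval x.
Proof. exact: big_seq1. Qed.

Lemma lprod_nseq k w : lprod (flatten (nseq k w)) = lprod w ^+ k.
Proof. by elim: k => [|k IHk] /=; rewrite ?lprod_nil // lprod_cat IHk expgS. Qed.

Hypothesis UU : forall j, U j * U j = 1.

Lemma leval_linv x : leval (linv x) = (leval x)^-1.
Proof.
case: x => [[k []]|j] /=; rewrite ?invgK //.
by apply/eqP; rewrite -mulg_eq1 UU.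
Qed.

Lemma lprod_lwinv w : lprod (lwinv w) = (lprod w)^-1.
Proof.
elim: w => [|x w IHw]; first by rewrite /lwinv lprod_nil invg1.
rewrite /lwinv /= rev_cons -cats1 lprod_cat lprod_seq1 leval_linv.
by rewrite -/(lwinv w) IHw lprod_cons invgM.
Qed.

End Evaluation.

Lemma gmulf_lprod (G1 G2 : groupType) (f : UMagmaMorphism.type G1 G2) P U w :
  f (lprod P U w) = lprod (f \o P) (f \o U) w.
Proof.
rewrite /lprod gmulf_prod; apply: eq_bigr => -[[k []]|j] _ //=.
by rewrite gmulfV.
Qed.

(** The [i]-th letter of [w] has to send the point [i] to [i.+1].  For one free
    generator these requirements form a partial injection, and for one involution
    a partial matching, precisely because no letter is followed by its inverse;
    both extend to the whole set. *)
Lemma reduced_word_perms (L : nat) (w : seq letter) :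
  (size w <= L)%N -> sorted lcompat w ->
  exists (P : K -> {perm 'I_L.+1}) (U : J -> {perm 'I_L.+1}),
    (forall j, U j * U j = 1) /\ lprod P U w (inord 0) = inord (size w).
Proof.
case: w => [|x0 w'] szL red.
  exists (fun=> 1), (fun=> 1); split=> [j|]; first exact: mulg1.
  by rewrite lprod_nil perm1.
move: red szL; set w := x0 :: w' => red szL.
have adj i : (i.+1 < size w)%N -> nth x0 w i.+1 != linv (nth x0 w i).
  by move=> iw; have /sortedP-/(_ x0 i iw) := red.
have /choice[P PE] k : exists p : {perm 'I_L.+1}, forall i, (i < size w)%N ->
    (nth x0 w i = inl (k, false) -> p (inord i) = inord i.+1) /\
    (nth x0 w i = inl (k, true) -> p (inord i.+1) = inord i).
  pose is_k i := (nth x0 w i == inl (k, false)) || (nth x0 w i == inl (k, true)).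
  pose pr i : 'I_L.+1 * 'I_L.+1 := if nth x0 w i == inl (k, false)
    then (inord i, inord i.+1) else (inord i.+1, inord i).
  have [|p pC] := @partial_perm_extension _ [seq pr i | i <- iota 0 (size w) & is_k i].
    rewrite pairwise_map.
    pose Q i := (i < size w)%N && is_k i.
    apply: (@sub_in_pairwise _ Q ltn) => [i j||].
    + move=> /andP[iw ik] /andP[jw jk] ij; rewrite /= in ij.
      have inord_eq u v : (u <= L)%N -> (v <= L)%N ->
          (inord u == inord v :> 'I_L.+1) = (u == v).
        by move=> uL vL; rewrite -val_eqE /= !inordK.
      have key b : i.+1 = j -> nth x0 w i = inl (k, b) ->
          nth x0 w j = inl (k, ~~ b) -> False.
        by move=> ? wi wj; subst j; have := adj i jw; rewrite wi wj eqxx.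
      have [jL iL] := (leq_trans jw szL, leq_trans iw szL).
      have [jL' iL'] := (ltnW jL, ltnW iL).
      rewrite /pr /=; move: ik jk; rewrite /is_k.
      have jneq : (i == j) = false by rewrite ltn_eqF.
      have jneqS : (i == j.+1) = false by rewrite ltn_eqF // ltnW.
      case: (nth x0 w i =P inl (k, false)) => [wi _|_ /= /eqP wi];
        case: (nth x0 w j =P inl (k, false)) => [wj _|_ /= /eqP wj];
        rewrite /= !inord_eq // ?eqSS ?jneq ?jneqS //=.
      * by apply/eqP => iS; apply: (key false).
      * by rewrite andbT; apply/eqP => iS; apply: (key true).
    + by apply/allP => i; rewrite mem_filter mem_iota andbC.
    rewrite -sorted_pairwise; last exact: ltn_trans.
    by rewrite sorted_filter ?iota_ltn_sorted //; apply: ltn_trans.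
  exists p => i iw; have prP : is_k i -> p (pr i).1 = (pr i).2.
    by move=> ik; apply/pC/map_f; rewrite mem_filter ik mem_iota.
  have neq : (inl (k, true) == inl (k, false) :> letter) = false by apply/eqP; case.
  by split=> wi; move: prP; rewrite /is_k /pr wi ?neq eqxx => /(_ isT).
have /choice[U UE] j : exists p : {perm 'I_L.+1}, p * p = 1 /\
    forall i, (i < size w)%N -> nth x0 w i = inr j -> p (inord i) = inord i.+1.
  pose is_j i := (i < size w)%N && (nth x0 w i == inr j).
  pose v (i : 'I_L.+1) : 'I_L.+1 := if is_j i then inord i.+1
    else if (0 < i)%N && is_j i.-1 then inord i.-1 else i.
  have is_jL i : is_j i -> (i.+1 < L.+1)%N by case/andP=> iw _; apply: leq_trans iw szL.
  have vK : involutive v.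
    move=> i; rewrite {2}/v; case: ifP => [ji|nji].
      rewrite /v inordK ?is_jL //= ji inord_val; case: ifP => // /andP[iw /eqP wiS].
      by have := adj i iw; rewrite wiS; case/andP: ji => _ /eqP->; rewrite eqxx.
    case: ifP => [/andP[i_gt0 ji]|nji']; last by rewrite /v nji nji'.
    rewrite /v inordK; last by rewrite ltnW // is_jL.
    by rewrite ji prednK // inord_val.
  exists (perm (inv_inj vK)); split=> [|i iw wi].
    by apply/permP => i; rewrite permM perm1 !permE vK.
  by rewrite permE /v inordK ?ltnS ?(leq_trans (ltnW iw)) // /is_j iw wi eqxx.
exists P, U; split=> [j|]; first exact: (UE j).1.
rewrite -{1}[w]take_size; elim: {-2}(size w) (leqnn (size w)) => [|n IHn] nw.
  by rewrite take0 lprod_nil perm1.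
rewrite (take_nth x0) // -cats1 lprod_cat permM IHn; last exact: ltnW.
rewrite lprod_seq1; case wn: (nth x0 w n) => [[k []]|j] /=.
- by apply: (canLR (permK _)); rewrite ((PE k n nw).2 wn).
- exact: (PE k n nw).1 wn.
- exact: (UE j).2 n nw wn.
Qed.

End FreeProductWords.

Lemma lprod_map (K J K' J' : eqType) (fK : K -> K') (fJ : J -> J')
    (G : groupType) (P : K' -> G) (U : J' -> G) w
    (fL := fun x : letter K J => match x with
       inl (k, b) => inl (fK k, b) | inr j => inr (fJ j) end : letter K' J') :
  lprod P U (map fL w) = lprod (P \o fK) (U \o fJ) w.
Proof.
by rewrite /lprod big_map; apply: eq_bigr => -[[k []]|j].
Qed.

(** * The base group and its periodic permutation representations *)
Section BaseWords.
Variable l : nat.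

(** The generators of the base: [inl (inl n)] stands for [p_n], [inl (inr i)] for
    the generator [a_(i+5)] and [inr n] for [u_n]. *)
Definition bletter := letter (int + 'I_l)%type int.
Definition bword := seq bletter.

Section BaseEvaluation.
Variables (G : groupType) (p u : int -> G) (e : 'I_l -> G).

Definition free_val (k : int + 'I_l) : G :=
  match k with inl n => p n | inr i => e i end.

Definition bval (w : bword) : G := lprod free_val u w.

(** For [t = true], the value of [c^n d^n], obtained by solving
    [u_n = p_n (c^n d^n) s_n]. *)
Definition stab_val (t : bool) (n : int) : G :=
  if t then (p n)^-1 * u n * (\prod_i zexp (e i) n)^-1 else p n.

End BaseEvaluation.

Definition s_word (n : int) : bword :=
  [seq inl (inr x.1, x.2) | x <- power_prod l n].

Definition stab_word (t : bool) (n : int) : bword :=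
  if t then [:: inl (inl n, true), inr n & lwinv (s_word n)]
  else [:: inl (inl n, false)].

(** The retraction of the base onto the subgroup generated by the
    [stab_word t n].  Killing the [u_n] and the [a_(i+5)] turns
    [q_n = p_n^-1 u_n s_n^-1] into [p_n^-1]; hence for [t = true] the letter [p_n]
    has to become [q_n^-1]. *)
Definition retract_letter (t : bool) (x : bletter) : bword :=
  match x with
  | inl (inl n, b) => if t (+) b then lwinv (stab_word t n) else stab_word t n
  | _ => [::]
  end.

Definition retract_word t (w : bword) : bword := flatten (map (retract_letter t) w).

Section BaseEvaluationLemmas.
Variables (G : groupType) (p u : int -> G) (e : 'I_l -> G).
Hypothesis uu : forall n, u n * u n = 1.

Lemma bval_s_word n : bval p u e (s_word n) = \prod_i zexp (e i) n.
Proof.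
rewrite -weval_power_prod /bval /lprod /weval big_map.
by apply: eq_bigr => -[i []].
Qed.

Lemma bval_lwinv w : bval p u e (lwinv w) = (bval p u e w)^-1.
Proof. exact: lprod_lwinv. Qed.

Lemma bval_stab_word t n : bval p u e (stab_word t n) = stab_val p u e t n.
Proof.
case: t => /=; last exact: lprod_seq1.
rewrite [LHS]lprod_cons lprod_cons -[lprod _ _ _]/(bval p u e _) bval_lwinv.
by rewrite bval_s_word mulgA.
Qed.

Lemma bval_retract_word t w :
  bval p u e (retract_word t w) =
  bval (fun n => if t then (stab_val p u e t n)^-1 else p n) (fun=> 1) (fun=> 1) w.
Proof.
elim: w => [|x w IHw]; first by rewrite /bval !lprod_nil.
rewrite /bval /= lprod_cat lprod_cons; congr (_ * _); last exact: IHw.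
case: x {IHw} => [[[n|i] b]|n]; rewrite ?lprod_nil //=; last by case: b; rewrite ?invg1.
move: (bval_lwinv (stab_word t n)) (bval_stab_word t n).
move: (stab_word t n) => W; rewrite /bval => Hl Hs.
by case: t Hs => Hs; case: b; rewrite /= ?Hl Hs ?invgK.
Qed.

End BaseEvaluationLemmas.

Definition nonzero_letter (x : bletter) : bool :=
  match x with
  | inl (inl n, _) => n != 0%R
  | inl (inr _, _) => true
  | inr n => n != 0%R
  end.

Definition reduced (w : bword) : bool :=
  sorted (@lcompat _ _) w && all nonzero_letter w.

Definition same_values (w w' : bword) : Prop :=
  forall (G : groupType) (p u : int -> G) (e : 'I_l -> G),
    p 0%R = 1 -> u 0%R = 1 -> (forall n, u n * u n = 1) ->
    bval p u e w = bval p u e w'.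

Lemma reduce_word w : exists2 w', reduced w' & same_values w w'.
Proof.
have [n] := ubnP (size w); elim: n w => // n IHn w.
rewrite ltnS leq_eqVlt => /orP[/eqP szw|]; last exact: IHn.
case: (boolP (all nonzero_letter w)) => [nzw|/allPn[x xw x0]]; last first.
  case/splitPr: xw szw => w1 w2 szw.
  have [|w' rw' ww'] := IHn (w1 ++ w2); first by rewrite -szw !size_cat /= addnS.
  exists w' => // G p u e p0 u0 uu; rewrite -ww' // /bval !lprod_cat lprod_cons.
  suff -> : leval (free_val p e) u x = 1 by rewrite mul1g.
  case: x x0 {szw} => [[[k|i] b]|k] //=; rewrite negbK => /eqP->; rewrite ?p0 //.
  by case: b; rewrite ?invg1.
case: (boolP (sorted (@lcompat _ _) w)) => [sw|]; first by exists w; rewrite ?/reduced ?sw.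
case/not_sortedP=> w1 [x [y [w2 [defw /negPn/eqP xy]]]]; subst w y.
have [|w' rw' ww'] := IHn (w1 ++ w2).
  by rewrite -szw !size_cat /= !addnS ltnW.
exists w' => // G p u e p0 u0 uu; rewrite -ww' // /bval !lprod_cat !lprod_cons.
by rewrite leval_linv // mulVKg.
Qed.

Definition letter_bound (x : bletter) : nat :=
  match x with inl (inl n, _) => `|n| | inl (inr _, _) => 0 | inr n => `|n| end.

Definition word_bound (w : bword) : nat :=
  maxn (size w) (\max_(x <- w) letter_bound x).

(** The period is the order of the symmetric group, so that [n]-th powers of
    permutations depend only on the residue of [n]; it is written as [q.+2] to
    have the ring structure on residues. *)
Section PeriodicData.
Variable b : nat.
Let q := (b.+3`!).-2.
Let Sym := {perm 'I_b.+3}.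

Lemma period_factE : q.+2 = b.+3`!.
Proof.
have : (2 < b.+3`!)%N by apply: leq_trans (fact_geq b.+3).
by rewrite /q; case: (_`!) => [|[|]].
Qed.

Definition rawdata :=
  ({ffun 'I_q.+2 -> Sym} * {ffun 'I_q.+2 -> Sym} * {ffun 'I_l -> Sym})%type.

Definition okdata (f : rawdata) : bool :=
  [&& f.1.1 0%R == 1, f.1.2 0%R == 1 & [forall k, f.1.2 k * f.1.2 k == 1]].

Definition data := {f : rawdata | okdata f}.
HB.instance Definition _ := Finite.on data.

Implicit Type f : data.
Definition dP f (k : 'I_q.+2) : Sym := (val f).1.1 k.
Definition dU f (k : 'I_q.+2) : Sym := (val f).1.2 k.
Definition dE f (i : 'I_l) : Sym := (val f).2 i.
Definition dS f (k : 'I_q.+2) : Sym := \prod_i dE f i ^+ k.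
Definition dQ t f k : Sym :=
  if t then (dP f k)^-1 * dU f k * (dS f k)^-1 else dP f k.

Definition dval f (w : bword) : Sym :=
  bval (fun n : int => dP f n%:~R%R) (fun n : int => dU f n%:~R%R) (dE f) w.

Lemma dP0 f : dP f 0%R = 1. Proof. by have /and3P[/eqP] := valP f. Qed.
Lemma dU0 f : dU f 0%R = 1. Proof. by have /and3P[_ /eqP] := valP f. Qed.
Lemma dUU f k : dU f k * dU f k = 1.
Proof. by have /and3P[_ _ /forallP/(_ k)/eqP] := valP f. Qed.
Lemma dS0 f : dS f 0%R = 1.
Proof. by rewrite /dS big1. Qed.
Lemma dQ0 t f : dQ t f 0%R = 1.
Proof. by rewrite /dQ dP0 dU0 dS0 invg1 !mulg1 if_same. Qed.

Lemma data_eq f f' : dP f =1 dP f' -> dU f =1 dU f' -> dE f =1 dE f' -> f = f'.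
Proof.
case: f f' => [[[P U] E] fP] [[[P' U'] E'] fP'] eP eU eE; apply: val_inj => /=.
by congr (_, _, _); apply/ffunP.
Qed.

Lemma mkdata (P U : 'I_q.+2 -> Sym) (E : 'I_l -> Sym) :
  P 0%R = 1 -> U 0%R = 1 -> (forall k, U k * U k = 1) ->
  {f : data | [/\ dP f =1 P, dU f =1 U & dE f =1 E]}.
Proof.
move=> P0 U0 UU; have ok : okdata (finfun P, finfun U, finfun E).
  by apply/and3P; split; rewrite ?ffunE ?P0 ?U0 //; apply/forallP => k; rewrite ffunE UU.
by exists (Sub _ ok); split=> k; rewrite [LHS]ffunE.
Qed.

Lemma zexp_mod (x : Sym) (n : int) : zexp x n = x ^+ (n%:~R%R : 'I_q.+2).
Proof.
have x_order : x ^+ q.+2 = 1.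
  have := @expg_cardG _ [set: Sym]%G x (finset.in_setT x); rewrite cardsT card_Sn -period_factE.
  exact.
have valS (k : 'I_q.+2) : x ^+ (k + 1)%R = x * x ^+ k.
  by rewrite -expgS /= expg_mod // addn1.
elim/int_shift_ind: n => [|n]; first by [].
by rewrite zexpS rmorphD /= valS; split=> [->//|/mulgI].
Qed.

Lemma prod_zexp_mod f n : \prod_i zexp (dE f i) n = dS f n%:~R%R.
Proof. by apply: eq_bigr => i _; apply: zexp_mod. Qed.

(** The automorphism [Q n |-> Q (n + 1) * (Q 1)^-1] by which a stable letter acts
    on its subgroup, transported to the data.  For [t = true] the value of [P] is
    the one that produces the wanted values of [dQ] with the same [U] and [E]. *)
Lemma shift_data_subproof t f :
  {f' : data | [/\ forall k, dQ t f' k = dQ t f (k + 1)%R * (dQ t f 1%R)^-1,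
                   dU f' =1 dU f & dE f' =1 dE f]}.
Proof.
pose Q k := dQ t f (k + 1)%R * (dQ t f 1%R)^-1.
pose P k := if t then dU f k * (dS f k)^-1 * (Q k)^-1 else Q k.
have Q0 : Q 0%R = 1 by rewrite /Q add0r mulgV.
have P0 : P 0%R = 1 by rewrite /P Q0 dU0 dS0 !invg1 !mulg1 if_same.
have [f' [eP eU eE]] := mkdata (dE f) P0 (dU0 f) (dUU f).
exists f'; split=> // k; rewrite -/(Q k).
have SE : dS f' k = dS f k by apply: eq_bigr => i _; rewrite eE.
rewrite /dQ eU eP SE /P; case: (t) => //.
by rewrite !invgM !invgK !mulgA mulgVK mulgK.
Qed.

Definition shift_data t f : data := sval (shift_data_subproof t f).

Lemma dQ_shift t f k :
  dQ t (shift_data t f) k = dQ t f (k + 1)%R * (dQ t f 1%R)^-1.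
Proof. by have [] := svalP (shift_data_subproof t f). Qed.

Lemma dU_shift t f : dU (shift_data t f) =1 dU f.
Proof. by have [] := svalP (shift_data_subproof t f). Qed.

Lemma dE_shift t f : dE (shift_data t f) =1 dE f.
Proof. by have [] := svalP (shift_data_subproof t f). Qed.

Lemma shift_data_inj t : injective (shift_data t).
Proof.
move=> f1 f2 f12.
have QE f k : dQ t f k = dQ t (shift_data t f) (k - 1)%R * (dQ t (shift_data t f) (- 1)%R)^-1.
  by rewrite !dQ_shift subrK addNr dQ0 mul1g invgK mulgVK.
have eQ k : dQ t f1 k = dQ t f2 k by rewrite QE f12 -QE.
have eU : dU f1 =1 dU f2 by move=> k; rewrite -(dU_shift t f1) f12 dU_shift.
have eE : dE f1 =1 dE f2 by move=> i; rewrite -(dE_shift t f1) f12 dE_shift.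
apply: data_eq => // k; have := eQ k; rewrite /dQ; case: t {f12 QE eQ} => //.
have -> : dS f2 k = dS f1 k by apply: eq_bigr => i _; rewrite eE.
by rewrite eU => /mulIg/mulIg/invg_inj.
Qed.

Lemma retract_data_subproof t f :
  {f' : data | (forall w, dval f' w = dval f (retract_word t w)) /\
               dQ t f' =1 dQ t f}.
Proof.
pose P k := if t then (dQ t f k)^-1 else dP f k.
have P0 : P 0%R = 1 by rewrite /P dQ0 dP0 invg1 if_same.
have [|f' [eP eU eE]] := @mkdata P (fun=> 1) (fun=> 1) P0 erefl.
  by move=> k; rewrite mulg1.
exists f'; split=> [w|k]; last first.
  rewrite /dQ eP eU /P; case: (t); rewrite ?invgK ?mulg1 //.
  by rewrite /dS big1 ?invg1 ?mulg1 // => i _; rewrite eE expg1n.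
rewrite /dval bval_retract_word => [|n]; last exact: dUU.
rewrite /bval /lprod; apply: eq_bigr => x _.
have eqP n : dP f' n%:~R%R = if t then (stab_val (fun n => dP f n%:~R%R)
    (fun n => dU f n%:~R%R) (dE f) t n)^-1 else dP f n%:~R%R.
  by rewrite eP /P /stab_val /dQ; case: (t); rewrite ?prod_zexp_mod.
by case: x => [[[n|i] c]|n] /=; rewrite ?eqP ?eU ?eE.
Qed.

Definition retract_data t f : data := sval (retract_data_subproof t f).

Lemma dval_retract t f w : dval (retract_data t f) w = dval f (retract_word t w).
Proof. exact: (svalP (retract_data_subproof t f)).1. Qed.

Lemma dQ_retract t f : dQ t (retract_data t f) =1 dQ t f.
Proof. exact: (svalP (retract_data_subproof t f)).2. Qed.

Lemma stab_val_data t f n :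
  stab_val (fun n => dP f n%:~R%R) (fun n => dU f n%:~R%R) (dE f) t n = dQ t f n%:~R%R.
Proof. by rewrite /stab_val /dQ; case: t; rewrite ?prod_zexp_mod. Qed.

Lemma residue_inj (n n' : int) : (`|n| <= b)%N -> (`|n'| <= b)%N ->
  n%:~R%R = n'%:~R%R :> 'I_q.+2 -> n = n'.
Proof.
move=> nb n'b /eqP; rewrite -subr_eq0 -rmorphB /= residue_eq0 ?subr_eq0; first by move/eqP.
rewrite period_factE; apply: leq_ltn_trans (leqD_dist _ 0%R _) _.
rewrite subr0 sub0r abszN; apply: leq_ltn_trans (leq_add nb n'b) _.
rewrite factS mulSn; apply: (@leq_trans (b.+2 * b.+2`!)); last exact: leq_addl.
rewrite addnn -mul2n; apply: (@leq_trans (b.+2 * 2)%N).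
  by rewrite mulnC ltn_pmul2r // ltnW.
by rewrite leq_pmul2l // (leq_trans _ (fact_geq b.+2)).
Qed.

(** The bound makes the residues of the indices in [w] distinct and nonzero, so
    [w] stays reduced after its indices are replaced by residues. *)
Lemma reduced_word_data w :
  reduced w -> w != [::] -> (word_bound w <= b)%N -> exists f, dval f w != 1.
Proof.
move=> /andP[sw nzw] w0; rewrite geq_max => /andP[szw /bigmax_leqP_seq bw].
pose fK (k : int + 'I_l) : 'I_q.+2 + 'I_l :=
  match k with inl n => inl n%:~R%R | inr i => inr i end.
pose fJ (n : int) : 'I_q.+2 := n%:~R%R.
pose fL (x : bletter) : letter ('I_q.+2 + 'I_l)%type 'I_q.+2 :=
  match x with inl (k, c) => inl (fK k, c) | inr j => inr (fJ j) end.
have fL_inj x y : x \in w -> y \in w -> fL y = linv (fL x) -> y = linv x.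
  move=> /bw/(_ isT) xb /bw/(_ isT) yb.
  case: x y xb yb => [[[n|i] c]|n] [[[n'|i'] c']|n'] //= nb n'b [].
  - by move=> /residue_inj-> // ->.
  - by move=> -> ->.
  - by move=> /residue_inj->.
have sfw : sorted (@lcompat _ _) (map fL w).
  rewrite sorted_map; apply: (@sub_in_sorted _ (mem w)) sw; last exact/allP.
  by move=> x y xw yw; apply: contra => /eqP/(fL_inj x y xw yw)->.
have [|P [U [UU PU]]] := @reduced_word_perms _ _ b.+2 (map fL w) _ sfw.
  by rewrite size_map; apply: leq_trans szw _; rewrite leqW.
pose P0 k := if k == 0%R then 1 else P (inl k).
pose U0 k := if k == 0%R then 1 else U k.
have UU0 k : U0 k * U0 k = 1 by rewrite /U0; case: ifP; rewrite ?mulg1.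
have [||f [eP eU eE]] := mkdata (fun i => P (inr i)) _ _ UU0 (P := P0).
- by rewrite /P0 eqxx.
- by rewrite /U0 eqxx.
exists f; suff -> : dval f w = lprod P U (map fL w).
  apply/eqP => E; move: PU; rewrite E perm1 => /(congr1 val).
  have szw3 : (size w < b.+3)%N by rewrite ltnS (leq_trans szw) // -addn2 leq_addr.
  rewrite /= size_map !inordK // => /esym/eqP.
  by rewrite size_eq0 (negPf w0).
rewrite lprod_map /dval /bval /lprod; apply: eq_big_seq => x xw.
have x_bd := bw x xw isT; have x_nz := allP nzw x xw.
have nz0 (n : int) : (`|n| <= b)%N -> n != 0%R -> (n%:~R == 0 :> 'I_q.+2)%R = false.
  move=> nb n0; apply/eqP => /(@residue_inj n 0 nb (leq0n _))/eqP.
  exact/negP.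
case: x x_bd x_nz {xw} => [[[n|i] c]|n] /= nb n0; rewrite ?eP ?eU ?eE /P0 /U0 ?nz0 //.
Qed.

End PeriodicData.
End BaseWords.

Lemma eq_bval l (G : groupType) (p p' u u' : int -> G) (e e' : 'I_l -> G) w :
  p =1 p' -> u =1 u' -> e =1 e' -> bval p u e w = bval p' u' e' w.
Proof.
move=> pp uu ee; apply: eq_bigr => -[[[n|i] b]|n] _ /=; by rewrite ?pp ?uu ?ee.
Qed.

Lemma gmulf_bval l (G H : groupType) (f : UMagmaMorphism.type G H)
    (p u : int -> G) (e : 'I_l -> G) w :
  f (bval p u e w) = bval (f \o p) (f \o u) (f \o e) w.
Proof.
rewrite /bval gmulf_lprod; apply: eq_bigr => -[[[n|i] b]|n] _ //=.
Qed.

(** * All periodic representations at once *)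
Section FiniteBase.
Variables l b : nat.
Let D := data l b.
Let q := (b.+3`!).-2.
Let Sym := {perm 'I_b.+3}.
Let B := {perm D * 'I_b.+3}.

(** A family of permutations, one for each datum, acts on the disjoint union of
    the copies of the permuted set; there the shift of the data acts too. *)
Fact fibre_inj (phi : D -> Sym) :
  injective (fun y : D * 'I_b.+3 => (y.1, phi y.1 y.2)).
Proof. by move=> [f z] [f' z'] [<- /perm_inj->]. Qed.
Definition fibre phi : B := perm (@fibre_inj phi).

Lemma fibreM phi psi : fibre phi * fibre psi = fibre (fun f => phi f * psi f).
Proof. by apply/permP => -[f z]; rewrite !permM !permE; congr (_, _); rewrite /= permM. Qed.

Lemma fibre1 : fibre (fun=> 1) = 1.
Proof. by apply/permP => -[f z]; rewrite perm1 permE /= perm1. Qed.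

Lemma fibreV phi : (fibre phi)^-1 = fibre (fun f => (phi f)^-1).
Proof.
apply: mulg1_eq; rewrite fibreM -fibre1; congr fibre.
by apply/funext => f; rewrite mulgV.
Qed.

Lemma fibre_eq phi psi : fibre phi = fibre psi -> phi =1 psi.
Proof.
move=> E f; apply/permP => z; have := congr1 (fun p : B => p (f, z)) E.
by rewrite !permE => -[].
Qed.

Definition Bp (n : int) : B := fibre (fun f => dP f n%:~R%R).
Definition Bu (n : int) : B := fibre (fun f => dU f n%:~R%R).
Definition Be (i : 'I_l) : B := fibre (fun f => dE f i).
Definition BQ t (k : 'I_q.+2) : B := fibre (fun f => dQ t f k).

Lemma BuBu n : Bu n * Bu n = 1.
Proof.
by rewrite fibreM -fibre1; congr fibre; apply/funext => f; apply: dUU.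
Qed.

Lemma bval_fibre w : bval Bp Bu Be w = fibre (fun f => dval f w).
Proof.
elim: w => [|x w IHw].
  by rewrite /bval lprod_nil -fibre1; congr fibre; apply/funext => f; rewrite /dval /bval lprod_nil.
rewrite /bval lprod_cons -/(bval Bp Bu Be w) IHw.
have -> : leval (free_val Bp Be) Bu x = fibre (fun f => leval (free_val
    (fun n => dP f n%:~R%R) (dE f)) (fun n => dU f n%:~R%R) x).
  by case: x => [[[n|i] []]|n]; rewrite /= ?fibreV.
by rewrite fibreM; congr fibre; apply/funext => f; rewrite /dval /bval lprod_cons.
Qed.

Lemma stab_val_fibre t n : stab_val Bp Bu Be t n = BQ t n%:~R%R.
Proof.
rewrite -bval_stab_word; last exact: BuBu.
rewrite bval_fibre; congr fibre; apply/funext => f; rewrite /dval bval_stab_word ?stab_val_data //.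
by move=> k; apply: dUU.
Qed.

Fact shift_act_inj t : injective (fun y : D * 'I_b.+3 => (shift_data t y.1, y.2)).
Proof. by move=> [f z] [f' z'] [/shift_data_inj-> ->]. Qed.
Definition shift_act t : B := perm (@shift_act_inj t).

Lemma shift_act_conj t k :
  (BQ t (k + 1)%R * (BQ t 1%R)^-1) ^ shift_act t = BQ t k.
Proof.
rewrite conjgE; apply: (mulgI (shift_act t)); rewrite mulVKg [BQ _ _]/BQ fibreV fibreM.
apply/permP => -[f z].
by rewrite !permM !permE /= dQ_shift permM.
Qed.

Definition stab_group t : {group B} := <<[set BQ t k | k : 'I_q.+2]>>%G.

Lemma mem_BQ t k : BQ t k \in stab_group t.
Proof. by apply/mem_gen/imset_f. Qed.

Lemma shift_act_norm t : shift_act t \in 'N(stab_group t).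
Proof.
have BQ0 : BQ t 0%R = 1.
  by rewrite -fibre1; congr fibre; apply/funext => f; apply: dQ0.
have conj1 : BQ t 1%R ^ shift_act t = (BQ t (- 1)%R)^-1.
  by rewrite -[in RHS](shift_act_conj t) addNr BQ0 mul1g conjVg invgK.
rewrite inE /= -genJ gen_subG; apply/fintype.subsetP => _ /imsetP[_ /imsetP[k _ ->] ->].
have -> : BQ t k = BQ t (k - 1 + 1)%R * (BQ t 1%R)^-1 * BQ t 1%R.
  by rewrite subrK mulgVK.
by rewrite conjMg shift_act_conj conj1 groupM ?groupV ?mem_BQ.
Qed.

(** [dQ] takes the same values at [f] and at [retract_data t f]; so the elements
    of [stab_group t] commute with the map [theta] between the two fibres, which
    need not be a permutation. *)
Lemma stab_group_retract t w (f : D) :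
  bval Bp Bu Be w \in stab_group t -> dval f w = dval f (retract_word t w).
Proof.
pose theta (y : D * 'I_b.+3) := (retract_data t y.1, y.2).
pose C := [set h : B | [forall y, h (theta y) == theta (h y)]].
have CP (h : B) : h \in C -> forall y, h (theta y) = theta (h y).
  by rewrite inE => /forallP hC y; apply/eqP.
have gC : group_set C.
  apply/group_setP; split=> [|h k /CP hC /CP kC].
    by rewrite inE; apply/forallP => y; rewrite !perm1.
  by rewrite inE; apply/forallP => y; rewrite !permM hC kC.
have sub : stab_group t \subset group gC.
  rewrite gen_subG; apply/fintype.subsetP => _ /imsetP[k _ ->]; rewrite inE.
  by apply/forallP => -[f' z]; rewrite !permE /= dQ_retract.
move=> /(fintype.subsetP sub)/CP E; rewrite -dval_retract; apply/permP => z.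
by have := E (f, z); rewrite bval_fibre !permE /= => -[].
Qed.

End FiniteBase.

Section StableLetters.
Variable l : nat.
Let G := Gl l.+4.

Definition gp (n : int) : G := zexp (@ga l) n * zexp (@gb l) n.
Definition wval (w : bword l) : G := bval gp (@gu l) (@ge l) w.
Definition stab (t : bool) : G := if t then @gc l else @ga l.

End StableLetters.

Section FiniteHNNQuotient.
Variables (l b N : nat).
Let D := data l b.
Let B := {perm D * 'I_b.+3}.
Variables (g : nat -> B) (s : nat -> bool * bool).
Hypothesis g_red : forall i, i.+1 < N ->
  s i.+1 = ((s i).1, ~~ (s i).2) -> g i.+1 \notin stab_group l b (s i).1.
Let G := Gl l.+4.

Local Notation rho := (@level_mul B N).

(** The second and the fourth generator are recovered from the stable letters [t]
    as [t^-1 Q_1].  Then [zexp_mul_telescope] computes the products of their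
    powers and the relators reduce to the squares of the [Bu n]. *)
Lemma finite_HNN_quotient :
  exists phi : UMagmaMorphism.type G {perm B * 'I_N.+1},
    (forall w, phi (wval w) = level_mul N (bval (@Bp l b) (@Bu l b) (@Be l b) w)) /\
    forall i, i < N -> phi (stab_act (@stab l) (s i)) (g i, inord i) = (1, inord i.+1).
Proof.
have [tau [tauH tauE]] := finite_HNN_path (@shift_act_norm l b) g_red.
pose Q t n : B := BQ l t n%:~R%R.
have Q0 t : Q t 0%R = 1.
  by rewrite -fibre1; congr fibre; apply/funext => f; apply: dQ0.
have QE t n : Q t n = stab_val (@Bp l b) (@Bu l b) (@Be l b) t n.
  by rewrite stab_val_fibre.
pose y t := (tau t)^-1 * rho (Q t 1%R).
have powE t n : zexp (tau t) n * zexp (y t) n = rho (Q t n).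
  move: n; apply: zexp_mul_telescope => [|n]; first by rewrite Q0 gmulf1.
  have := tauH t (Q t (n + 1)%R * (Q t 1%R)^-1).
  rewrite groupM ?groupV ?mem_BQ // => /(_ isT).
  rewrite /Q rmorphD /= shift_act_conj -/(Q t n) => tauQ.
  by rewrite /y !mulgA -tauQ mulgK -gmulfM mulgVK.
have blkE n : blk (tau false) (y false) (tau true) (y true) (rho \o @Be l b) n
    = rho (Bu l b n).
  rewrite /blk !powE !QE; have -> : \prod_i zexp ((rho \o @Be l b) i) n =
      rho (\prod_i zexp (@Be l b i) n).
    by rewrite gmulf_prod; apply: eq_bigr => i _; rewrite gmulf_zexp.
  by rewrite -!gmulfM /stab_val !mulgA mulgV mul1g mulgVK.
have [|phi [pa pb pc pd pe]] :=
    @Gl_hom l _ (tau false) (y false) (tau true) (y true) (rho \o @Be l b).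
  by move=> n; rewrite blkE expg2 -gmulfM BuBu gmulf1.
exists phi; split=> [w|i iN].
  rewrite /wval gmulf_bval /= gmulf_bval; apply: eq_bval => [n|n|i] /=.
  - by rewrite /gp gmulfM !gmulf_zexp pa pb powE QE.
  - rewrite -blkE /gu /blk !gmulfM !gmulf_zexp pa pb pc pd gmulf_prod.
    by congr (_ * _); apply: eq_bigr => i _; rewrite gmulf_zexp pe.
  - exact: pe.
rewrite -[RHS]tauE // /stab_act; case: (s i) => [[] []] /=;
  by rewrite ?gmulfV /stab ?pa ?pc.
Qed.

End FiniteHNNQuotient.

(** * Normal forms and residual finiteness *)
Section NormalForms.
Variable l : nat.
Let G := Gl l.+4.
Local Notation gp := (@gp l).
Local Notation gu := (@gu l).
Local Notation ge := (@ge l).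
Local Notation wval := (@wval l).
Local Notation stab := (@stab l).

Definition syllable := ((bool * bool) * bword l)%type.
Implicit Types (x y : syllable) (ss : seq syllable).

Definition syl_val x : G := stab_act stab x.1 * wval x.2.
Definition syls_val ss : G := \prod_(x <- ss) syl_val x.

(** [syl_compat x y] excludes a pinch: a stable letter and its inverse around an
    element of the subgroup that it normalises.  Membership in this subgroup is
    expressed as invariance under the retraction. *)
Definition syl_compat : rel syllable := fun x y =>
  `[< ~ (y.1 = (x.1.1, ~~ x.1.2) /\ wval x.2 = wval (retract_word x.1.1 x.2)) >].

Lemma gugu n : gu n * gu n = 1.
Proof. by rewrite -expg2; apply: Gl_rel. Qed.

Lemma gp0 : gp 0%R = 1. Proof. by rewrite /gp mulg1. Qed.

Lemma gu0 : gu 0%R = 1.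
Proof. by rewrite /gu /blk !zexp0 !mulg1 big1 ?mulg1. Qed.

Lemma wval_cat u v : wval (u ++ v) = wval u * wval v.
Proof. exact: lprod_cat. Qed.

Lemma wval_lwinv w : wval (lwinv w) = (wval w)^-1.
Proof. exact/lprod_lwinv/gugu. Qed.

Lemma stab_valE t n : stab_val gp gu ge t n =
  if t then zexp (@gc l) n * zexp (@gd l) n else zexp (@ga l) n * zexp (@gb l) n.
Proof.
case: t => //; rewrite /stab_val.
have -> : gu n = gp n * (zexp (@gc l) n * zexp (@gd l) n) * \prod_i zexp (ge i) n by [].
by rewrite -(mulgA (gp n)) mulKg mulgK.
Qed.


Lemma same_wval w w' : same_values w w' -> wval w = wval w'.
Proof. by apply; [exact: gp0|exact: gu0|exact: gugu]. Qed.

Lemma same_dval b w w' (f : data l b) : same_values w w' -> dval f w = dval f w'.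
Proof.
by apply; [exact: dP0|exact: dU0|move=> n; exact: dUU].
Qed.

Lemma data_separates w : wval w <> 1 ->
  exists b0, forall b, (b0 <= b)%N -> exists f : data l b, dval f w != 1.
Proof.
have [w' rw' /[dup] /same_wval-> ww'] := reduce_word w => w'1.
exists (word_bound w') => b wb.
have [|f f1] := @reduced_word_data l b w' rw' _ wb.
  by apply/eqP => w0; apply: w'1; rewrite w0 /wval /bval lprod_nil.
by exists f; rewrite (same_dval f ww').
Qed.

(** One size [b] serves finitely many words, since each of them is detected for
    all large [b]. *)
Lemma data_separates_all (ws : seq (bword l)) :
  exists b, forall w, w \in ws -> wval w <> 1 -> exists f : data l b, dval f w != 1.
Proof.
suff [b0 P] : exists b0, forall b, (b0 <= b)%N -> forall w, w \in ws -> wval w <> 1 ->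
    exists f : data l b, dval f w != 1 by exists b0; apply: P.
elim: ws => [|w ws [b1 IH]]; first by exists 0.
have [w1|/data_separates[b2 P]] := pselect (wval w = 1).
  exists b1 => b bb w'; rewrite inE => /predU1P[->|]; [by []|exact: IH].
exists (maxn b1 b2) => b; rewrite geq_max => /andP[b1b b2b] w'.
by rewrite inE => /predU1P[-> _|]; [exact: P|exact: IH].
Qed.

Lemma base_quotient b w (f : data l b) : dval f w != 1 ->
  exists (Q : finGroupType) (phi : UMagmaMorphism.type G Q), phi (wval w) <> 1.
Proof.
move=> fw; have [//|phi [phiB _]] :=
  @finite_HNN_quotient l b 0 (fun=> 1) (fun=> (false, false)).
exists {perm {perm (data l b * 'I_b.+3)} * 'I_1}, phi; rewrite phiB => fw1.
have /level_mul_free : level_mul 0 (bval (@Bp l b) (@Bu l b) (@Be l b) w) (1, ord0) = (1, ord0).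
  by rewrite fw1 perm1.
by rewrite bval_fibre -fibre1 => /fibre_eq/(_ f) fw'; rewrite fw' eqxx in fw.
Qed.

Lemma reduced_wval_neq1 w : reduced w -> w != [::] -> wval w <> 1.
Proof.
move=> rw w0 w1; have [f fw] := reduced_word_data rw w0 (leqnn _).
by have [Q [phi]] := base_quotient fw; rewrite w1 gmulf1.
Qed.


(** Choose [b] such that the finite base detects [r0] and the difference between
    [r] and its retract for each base word [r] of the expression.  By
    [stab_group_retract] the expression remains reduced in the finite base, so it
    climbs [size ss] levels; without stable letters, [r0] itself is detected. *)
Lemma reduced_separated (r0 : bword l) ss :
  sorted syl_compat ss -> (ss != [::] \/ wval r0 <> 1) ->
  exists (Q : finGroupType) (phi : UMagmaMorphism.type G Q),
    phi (wval r0 * syls_val ss) <> 1.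
Proof.
have [-> _ [//|r01]|ss0 red _] := eqVneq ss [::].
  have [b fP] := data_separates r01; have [f fr] := fP b (leqnn b).
  by rewrite /syls_val big_nil mulg1; apply: base_quotient fr.
pose N := size ss; pose x0 : syllable := ((false, false), [::]).
pose sep x := x.2 ++ lwinv (retract_word x.1.1 x.2).
have [b bP] := data_separates_all (r0 :: map sep ss).
pose vB := bval (@Bp l b) (@Bu l b) (@Be l b).
pose r i := nth [::] (r0 :: map snd ss) i; pose s i := (nth x0 ss i).1.
have rS i : i < N -> r i.+1 = (nth x0 ss i).2.
  by move=> iN; rewrite /r /= (nth_map x0).
have [|phi [phiB phiS]] := @finite_HNN_quotient l b N (vB \o r) s.
  move=> i iN si; apply/negP => /(@stab_group_retract _ _ _ (r i.+1)) ret.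
  have iN' := ltnW iN; rewrite rS // in ret.
  have /sortedP-/(_ x0 i iN)/asboolP := red; apply; split=> //; apply: contrapT => neq.
  have [||f] := bP (sep (nth x0 ss i)).
  - by rewrite inE map_f ?orbT // mem_nth.
  - rewrite /sep wval_cat wval_lwinv => /eqP; rewrite mulg_eq1 invgK => /eqP; exact: neq.
  case/negP; rewrite /sep /dval /bval lprod_cat lprod_lwinv; last by move=> n; apply: dUU.
  by rewrite mulg_eq1 invgK; apply/eqP/ret.
exists {perm {perm (data l b * 'I_b.+3)} * 'I_N.+1}, phi => phi1.
have track k i : (i + k)%N = N ->
    (phi (wval (r i) * syls_val (drop i ss)) (1, inord i)).2 = inord N.
  elim: k i => [|k IHk] i ikN.
    rewrite addn0 in ikN; rewrite drop_oversize ?ikN // /syls_val big_nil mulg1.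
    by rewrite phiB permE.
  have iN : i < N by rewrite -ikN addnS ltnS leq_addr.
  rewrite (drop_nth x0) // /syls_val big_cons -/(syls_val _) {1}/syl_val.
  rewrite -!mulgA mulgA gmulfM permM gmulfM permM phiB.
  rewrite permE /= mul1g -/vB [phi (stab_act _ _ * _)]gmulfM permM -/(s i).
  have -> : phi (stab_act stab (s i)) (vB (r i), inord i) = (1, inord i.+1) := phiS i iN.
  rewrite -rS // -permM -gmulfM; apply: IHk.
  by rewrite -ikN addnS.
have := track N 0 erefl; rewrite drop0 phi1 perm1 => /(congr1 val) /=.
by rewrite !inordK // => /esym/eqP; rewrite size_eq0 (negPf ss0).
Qed.


(** [N] stable letters suffice to write [g]; the number need not be minimal. *)
Definition has_length N (g : G) : Prop :=
  exists (r0 : bword l) ss, size ss = N /\ g = wval r0 * syls_val ss.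

Lemma syls_val_cat ss1 ss2 : syls_val (ss1 ++ ss2) = syls_val ss1 * syls_val ss2.
Proof. exact: big_cat. Qed.

Lemma syls_val_cons x ss : syls_val (x :: ss) = syl_val x * syls_val ss.
Proof. exact: big_cons. Qed.

Lemma has_length_wval w : has_length 0 (wval w).
Proof. by exists w, [::]; rewrite /syls_val big_nil mulg1. Qed.

Lemma wval_nil : wval [::] = 1.
Proof. exact: lprod_nil. Qed.

Lemma has_length_stab e : has_length 1 (stab_act stab e).
Proof.
exists [::], [:: (e, [::])].
by rewrite syls_val_cons /syls_val big_nil /syl_val wval_nil mul1g !mulg1.
Qed.

Lemma has_lengthM N M g h :
  has_length N g -> has_length M h -> has_length (N + M) (g * h).
Proof.
move=> [r0 [ss [<- ->]]] [r1 [ss1 [<- ->]]].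
elim/last_ind: ss => [|ss [e r] _].
  by exists (r0 ++ r1), ss1; rewrite wval_cat /syls_val big_nil mulg1 mulgA.
exists r0, (rcons ss (e, r ++ r1) ++ ss1); rewrite size_cat !size_rcons; split=> //.
rewrite -!cats1 !syls_val_cat !syls_val_cons /syl_val /= wval_cat.
by rewrite /syls_val big_nil !mulg1 !mulgA.
Qed.

Lemma stab_actV e : (stab_act stab e)^-1 = stab_act stab (e.1, ~~ e.2).
Proof. by case: e => t [] //=; rewrite /stab_act /= invgK. Qed.

Lemma has_lengthV N g : has_length N g -> has_length N g^-1.
Proof.
move=> [r0 [ss [<- ->]]]; elim/last_ind: ss => [|ss [e r] IH].
  rewrite /syls_val big_nil mulg1 -wval_lwinv; exact: has_length_wval.
rewrite size_rcons -cats1 syls_val_cat syls_val_cons /syls_val big_nil mulg1 -/(syls_val ss).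
rewrite mulgA invgM /syl_val invgM /= -wval_lwinv stab_actV.
rewrite -add1n; apply: has_lengthM IH; rewrite -[1%N]add0n.
by apply: has_lengthM; [exact: has_length_wval|exact: has_length_stab].
Qed.

(** The stable letters normalise the image of their retraction: both
    [t Q_n t^-1 = Q_(n+1) Q_1^-1] and [t^-1 Q_n t = Q_(n-1) Q_(-1)^-1] follow from
    [Q_n = a^n b^n]. *)
Lemma conj_retract e w :
  has_length 0 (stab_act stab e * wval (retract_word e.1 w) * (stab_act stab e)^-1).
Proof.
set c := stab_act stab e; have -> (g : G) : c * g * c^-1 = g ^ c^-1.
  by rewrite conjgE invgK mulgA.
case: e @c => t s /=; set c := stab_act stab _.
have L0V g : has_length 0 g -> has_length 0 g^-1 by apply: has_lengthV.
have L0M g h : has_length 0 g -> has_length 0 h -> has_length 0 (g * h).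
  by apply: has_lengthM.
pose Q n := wval (stab_word l t n); pose a := stab t.
have QE n : Q n = zexp a n * zexp (if t then @gd l else @gb l) n.
  rewrite /Q /wval bval_stab_word ?stab_valE /a; last exact: gugu.
  by rewrite /stab; case: (t).
have Q_up n : a * Q n * a^-1 = Q (n + 1)%R * (Q 1%R)^-1.
  rewrite !QE zexpS zexpSr !(zexpS _ 0) !mulg1 invgM !mulgA mulgK.
  by [].
have cQ n : has_length 0 (Q n ^ c^-1).
  have LQ k : has_length 0 (Q k) by apply: has_length_wval.
  rewrite /c /stab_act /=; case: (s); rewrite conjgE !invgK mulgA -/a; last first.
    by rewrite Q_up; apply/L0M/L0V.
  have -> : a^-1 * Q n * a = Q (n - 1)%R * (Q (- 1)%R)^-1.
    apply: (mulgI a); apply: (mulIg a^-1); rewrite !mulgA mulgK mulgV mul1g.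
    have -> : a * Q (n - 1)%R * (Q (- 1)%R)^-1 * a^-1 =
      (a * Q (n - 1)%R * a^-1) * (a * Q (- 1)%R * a^-1)^-1.
      by rewrite !invgM !invgK !mulgA mulgVK.
    rewrite !Q_up subrK addNr invgM invgK mulgA mulgVK.
    by rewrite (_ : Q 0%R = 1) ?invg1 ?mulg1 // QE mulg1.
  exact/L0M/L0V.
elim: w => [|x w IHw]; first by rewrite wval_nil conj1g -wval_nil; apply: has_length_wval.
rewrite /retract_word /= wval_cat conjMg; apply: L0M; last exact: IHw.
case: x => [[[n|i] b]|n] /=; try by rewrite wval_nil conj1g -wval_nil; apply: has_length_wval.
by case: (t (+) b); rewrite ?wval_lwinv ?conjVg; [apply: L0V|]; apply: cQ.
Qed.

Lemma not_reduced_shorten r0 ss : ~~ sorted syl_compat ss ->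
  exists2 N, (N < size ss)%N & has_length N (wval r0 * syls_val ss).
Proof.
case/not_sortedP=> s1 [x [y [s2 [-> /asboolPn/contrapT[y1 xr]]]]].
exists (size s1 + size s2)%N; first by rewrite size_cat /= !addnS !ltnS leqnSn.
have -> : wval r0 * syls_val (s1 ++ x :: y :: s2) = wval r0 * syls_val s1 *
    (stab_act stab x.1 * wval (retract_word x.1.1 x.2) * (stab_act stab x.1)^-1) *
    (wval y.2 * syls_val s2).
  rewrite syls_val_cat !syls_val_cons /syl_val xr stab_actV y1 !mulgA.
  by rewrite -xr.
rewrite -[size s1]addn0; apply: has_lengthM; last by exists y.2, s2.
by apply: has_lengthM; [exists r0, s1|exact: conj_retract].
Qed.

Lemma has_length_ex g : exists N, has_length N g.
Proof.
have L0 w : exists N, has_length N (wval w) by exists 0; apply: has_length_wval.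
have LM (x y : G) : (exists N, has_length N x) -> (exists N, has_length N y) ->
    exists N, has_length N (x * y).
  by move=> [N Nx] [M My]; exists (N + M)%N; apply: has_lengthM.
have LV (x : G) : (exists N, has_length N x) -> exists N, has_length N x^-1.
  by move=> [N Nx]; exists N; apply: has_lengthV.
have Ls t : exists N, has_length N (stab t).
  by exists 1%N; apply: (has_length_stab (t, false)).
have Ld t : (if t then @gd l else @gb l) = (stab t)^-1 * wval (stab_word l t 1%R).
  rewrite /wval bval_stab_word ?stab_valE; last exact: gugu.
  by rewrite /stab; case: t; rewrite !(zexpS _ 0) !mulg1 mulKg.
elim/Gl_ind: g => //.
- by rewrite -wval_nil.
- exact: (Ls false).
- by rewrite (Ld false); apply: LM => //; apply: LV.
- exact: (Ls true).
- by rewrite (Ld true); apply: LM => //; apply: LV.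
- move=> i; have -> : ge i = wval [:: inl (inr i, false)] by rewrite /wval /bval lprod_seq1.
  exact: L0.
Qed.

Lemma Gl_residually_finite : residually_finite G.
Proof.
move=> g; have [N] := has_length_ex g.
have [M] := ubnP N; elim: M N g => // M IHM N g; rewrite ltnS => NM.
case=> [r0 [ss [ssN gE]]] g1.
have [red|] := boolP (sorted syl_compat ss).
  rewrite gE; apply: reduced_separated => //.
  have [ss0|] := eqVneq ss [::]; [right|by left].
  by move: g1; rewrite gE ss0 /syls_val big_nil mulg1.
case/(not_reduced_shorten r0) => N'; rewrite ssN => N'N; rewrite -gE => gN'.
by apply: IHM gN' g1; apply: leq_trans N'N NM.
Qed.

End NormalForms.

(** * Torsion and finite subgroups *)
Section Torsion.
Variable l : nat.
Let G := Gl l.+4.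
Local Notation wval := (@wval l).
Local Notation gu := (@gu l).

Definition conj_involution (g : G) : Prop :=
  exists (n : int) (h : G), n != 0%R /\ g = gu n ^ h.

Lemma conj_involutionJ g h : conj_involution (g ^ h) -> conj_involution g.
Proof.
move=> [n [k [n0 gh]]]; exists n, (k * h^-1); split=> //.
by rewrite conjgM -gh conjgK.
Qed.

Lemma reduced_flatten_nseq k (w : bword l) :
  path.cycle (@lcompat _ _) w -> all (@nonzero_letter l) w ->
  reduced (flatten (nseq k w)).
Proof.
move=> cw nzw; rewrite /reduced sorted_flatten_nseq //=.
by elim: k => //= k IHk; rewrite all_cat nzw.
Qed.

(** A reduced word of finite order is not cyclically reduced, as the powers of a
    cyclically reduced one are reduced.  So its ends cancel after conjugation,
    and this goes on down to a single letter of order two. *)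
Lemma torsion_base_word (w : bword l) k :
  (0 < k)%N -> wval w ^+ k = 1 -> wval w = 1 \/ conj_involution (wval w).
Proof.
move=> k_gt0; have [w' rw' /same_wval->] := reduce_word w; move: w' rw' => {}w.
have [n] := ubnP (size w); elim: n w => // n IHn w; rewrite ltnS => szw rw wk.
have no_cycle : w != [::] -> path.cycle (@lcompat _ _) w -> False.
  move=> w0 cw; have /andP[_ nzw] := rw.
  apply: (reduced_wval_neq1 (reduced_flatten_nseq k cw nzw)).
    by rewrite -size_eq0 size_flatten /shape map_nseq sumn_nseq muln_eq0 size_eq0
      negb_or w0 -lt0n.
  by rewrite [LHS]lprod_nseq.
case: w szw rw wk no_cycle => [|x p] szw rw wk no_cycle.
  by left; apply: wval_nil.
case/lastP: p szw rw wk no_cycle => [|p y] szw rw wk no_cycle.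
  case: x szw rw wk no_cycle => [[k' b]|m] szw rw wk no_cycle.
    case: (no_cycle isT); rewrite /= andbT; apply/eqP => -[]; by case: (b).
  right; exists m, 1; rewrite conjg1; split; last exact: lprod_seq1.
  by move: rw; rewrite /reduced /= andbT.
have [xy|yx] := eqVneq x (linv y); last first.
  case: (no_cycle isT); rewrite /= rcons_path last_rcons; apply/andP; split=> //.
  by case/andP: rw.
have conj_p : wval (x :: rcons p y) = wval p ^ (leval (free_val (@gp l) (@ge l)) gu y).
  rewrite /wval /bval lprod_cons -cats1 lprod_cat lprod_seq1 xy leval_linv.
    by rewrite conjgE.
  exact: gugu.
have rp : reduced p.
  move: rw; rewrite /reduced /= all_rcons rcons_path.
  by case/andP=> /andP[/path_sorted-> _] /and3P[].
have [||p1|] := IHn p _ rp.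
- move: szw; rewrite /= size_rcons; exact: leq_trans.
- apply: (conjg_inj (leval (free_val (@gp l) (@ge l)) gu y)).
  by rewrite conjXg -conj_p wk conj1g.
- by left; rewrite conj_p p1 conj1g.
- by move=> [m [h [m0 pE]]]; right; exists m, (h * leval (free_val (@gp l) (@ge l)) gu y);
  rewrite conjgM -pE.
Qed.

(** A pinch between the last and the first syllable becomes an inner one after a
    rotation.  A single syllable is never in a pinch with itself, as its stable
    letter is not its own inverse. *)
Lemma not_cycle_rotate (ss : seq (syllable l)) : ~~ path.cycle (@syl_compat l) ss ->
  exists ss' h, [/\ size ss' = size ss, syls_val ss' = syls_val ss ^ h
                  & ~~ sorted (@syl_compat l) ss'].
Proof.
case: ss => // x p; rewrite /= rcons_path negb_and.
case/orP=> [np|nl]; first by exists (x :: p), 1; rewrite conjg1.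
case/lastP: p nl => [|p y] /=.
  by move/asboolPn/contrapT=> [/(congr1 snd) /= /eqP]; rewrite eq_sym; case: (_.2).
rewrite last_rcons => yx; exists (y :: x :: p), (syl_val y)^-1.
rewrite /= size_rcons (negPf yx); split=> //.
have -> : syls_val (x :: rcons p y) = syls_val (x :: p) * syl_val y.
  by rewrite -rcons_cons -cats1 syls_val_cat /syls_val big_seq1.
by rewrite (syls_val_cons y) conjgE invgK mulgK.
Qed.

(** Move the initial base word to the end by conjugation.  If the cyclic sequence
    of syllables has no pinch, all powers of [g] are reduced, hence nontrivial;
    otherwise a conjugate of [g] needs fewer stable letters. *)
Lemma torsion_conj_involution (g : G) k :
  (0 < k)%N -> g ^+ k = 1 -> g = 1 \/ conj_involution g.
Proof.
move=> k_gt0; have [N] := has_length_ex g.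
have [M] := ubnP N; elim: M N g => // M IHM N g; rewrite ltnS => NM.
case=> [r0 [ss [ssN gE]]] gk.
case/lastP: ss ssN gE => [|ss [e r]] ssN gE.
  move: gk; rewrite gE /syls_val big_nil mulg1; exact: torsion_base_word.
pose ss' := rcons ss (e, r ++ r0).
have gJ : g ^ wval r0 = syls_val ss'.
  rewrite gE /ss' -!cats1 !syls_val_cat !syls_val_cons /syls_val big_nil !mulg1.
  by rewrite conjgE /syl_val /= wval_cat !mulgA mulVg mul1g.
have ssN' : size ss' = N by rewrite -ssN !size_rcons.
have [cyc|/not_cycle_rotate[ss2 [h [sz2 val2 ns2]]]] := boolP (path.cycle (@syl_compat l) ss').
  have red := sorted_flatten_nseq k cyc.
  have [|Q [phi]] := @reduced_separated l [::] _ red.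
    left; rewrite -size_eq0 size_flatten /shape map_nseq sumn_nseq muln_eq0 negb_or.
    by rewrite -!lt0n k_gt0 size_rcons.
  have -> : syls_val (flatten (nseq k ss')) = syls_val ss' ^+ k.
    by elim: (k) => [|j IHj] /=; rewrite ?[LHS]big_nil // syls_val_cat IHj expgS.
  by rewrite -gJ -conjXg gk conj1g wval_nil mulg1 gmulf1.
have [N' N'lt] := not_reduced_shorten [::] ns2.
rewrite wval_nil mul1g val2 -gJ -conjgM => gN'.
have [||g1|gi] := IHM N' (g ^ (wval r0 * h)) _ gN'.
- by apply: leq_trans NM; rewrite -ssN' -sz2.
- by rewrite -conjXg gk conj1g.
- by left; apply/eqP; rewrite -(conjg_eq1 g (wval r0 * h)) g1.
- by right; apply: conj_involutionJ gi.
Qed.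

Local Open Scope classical_set_scope.

Lemma finite_subgroup_torsion (H : groupClosed G) x :
  finite_set [set` H] -> x \in H -> exists2 k, (0 < k)%N & x ^+ k = 1.
Proof.
move=> fin Hx; apply: contrapT => noK.
have x_inj : injective (fun i => x ^+ i).
  suff lt_neq i j : (i < j)%N -> x ^+ i <> x ^+ j.
    by move=> i j ij; case: (ltngtP i j) => // /lt_neq; rewrite ij.
  move=> ij eq_ij; apply: noK; exists (j - i)%N; first by rewrite subn_gt0.
  apply: (mulgI (x ^+ i)); rewrite -expgnDr subnKC ?mulg1 //; exact: ltnW.
apply: infinite_nat.
rewrite (_ : setT = (fun i => x ^+ i) @^-1` [set` H]).
  by apply: finite_preimage => // i j _ _; apply: x_inj.
by apply/seteqP; split=> // i _; apply: (gpredXn (S := H)).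
Qed.

(** For [m] large, the [m]-th Heisenberg quotient maps the two factors and their
    product to the same central involution. *)
Lemma conj_involution_pair (g h : G) : conj_involution g -> conj_involution h ->
  ~ conj_involution (g * h).
Proof.
move=> [n1 [k1 [n10 ->]]] [n2 [k2 [n20 ->]]] [n3 [k3 [n30 gh]]].
pose m := (`|n1| + `|n2| + `|n3|)%N.
have [phi [phiC phiu]] := heisenberg_quotient m l.
have phiE n k : n != 0%R -> (`|n| <= m)%N -> phi (gu n ^ k) = hneg m.
  move=> n0 nm; rewrite gmulfJ phiu residue_eq0 ?(negPf n0); last by rewrite ltnW.
  by rewrite conjgE phiC mulKg.
have b1 : (`|n1| <= m)%N by rewrite /m -addnA leq_addr.
have b2 : (`|n2| <= m)%N by rewrite /m -addnA addnCA leq_addr.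
have b3 : (`|n3| <= m)%N by apply: leq_addl.
have := congr1 phi gh; rewrite gmulfM !phiE // => /(congr1 (fun p => p * (hneg m)^-1)).
rewrite mulgK mulgV => /permP/(_ ([ffun=> false], false)).
by rewrite perm1 permE.
Qed.

(** Three distinct elements [x 0], [x 1], [x 2] would give the involutions
    [(x 0)^-1 * x 1] and [(x 1)^-1 * x 2] with the involution [(x 0)^-1 * x 2] as
    product. *)
Lemma finite_subgroup_card (H : groupClosed G) (n : nat) :
  ([set` H] #= `I_n)%card -> (n <= 2)%N.
Proof.
move=> Hn; rewrite leqNgt; apply/negP => n3.
have finH : finite_set [set` H] by exists n.
have [f bij] := elimT card_set_bijP Hn.
have /choice[x xP] (i : nat) : exists x, (i < n)%N -> x \in H /\ f x = i.
  have [iN|] := boolP (i < n)%N; last by exists 1.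
  by have [x Hx <-] := set_bij_surj bij iN; exists x.
have inv y : y \in H -> y <> 1 -> conj_involution y.
  move=> Hy y1; have [k k0 yk] := finite_subgroup_torsion finH Hy.
  by have [] := torsion_conj_involution k0 yk.
have fV i j : (i < n)%N -> (j < n)%N -> i != j -> conj_involution ((x i)^-1 * x j).
  move=> iN jN /eqP ij; have [[Hi fi] [Hj fj]] := (xP i iN, xP j jN).
  apply: inv => [|E]; first by rewrite gpredM // gpredV.
  by apply: ij; rewrite -fi -fj -(mulKVg (x i) (x j)) E mulg1.
have [n0 n1] : (0 < n)%N /\ (1 < n)%N by split; [apply: leq_trans n3|apply: ltnW].
case: (conj_involution_pair (fV 0%N 1%N n0 n1 isT) (fV 1%N 2%N n1 n3 isT)).
rewrite mulgA mulgK; exact: fV.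
Qed.

End Torsion.

Local Open Scope classical_set_scope.
Local Open Scope card_scope.

Theorem proposition10p2 (l : nat) (hl : (12 <= l)%N) :
  [/\ residually_finite (Gl l),
      ~ virtually_torsion_free (Gl l),
      ~ linear_in_char0 (Gl l) &
      forall (H : groupClosed (Gl l)) (n : nat),
        [set` H] #= `I_n -> (n <= 2)%N].
Proof.
have [l' ->] : exists l', l = l'.+4.
  by exists (l - 4)%N; rewrite -addn4 subnK //; apply: leq_trans hl.
split.
- exact: Gl_residually_finite.
- exact: Gl_not_virtually_torsion_free.
- exact: Gl_not_linear.
- exact: finite_subgroup_card.
Qed.
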